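(* Suppose that each $f_i$, $i\in\mathcal I$, is uniformly bounded, and that for every $i\in\mathcal I$: (1) $h_i(t,\xi)$ is uniformly bounded, measurable in $t$, continuous in $\xi$ uniformly in $t$, and precompact; (2) $f_i=\hat f_i+\Delta f_i$, where (a) $\hat f_i(t,\xi)$ is uniformly bounded, measurable in $t$, continuous in $\xi$ uniformly in $t$, and precompact, and (b) $(h_i,\Delta f_i)$ is a zeroing pair. Let $\mathcal T$ be a family of trajectories of the switched system $\dot x=f(t,x,\sigma)$ which is invariant with respect to a closed covering $\chi=\{\chi_i\}_{i\in\mathcal I}$ of $\mathbb R^n$. If $(\bar x,\bar u)$ is a $\mathcal T$-zeroing-output limiting trajectory, then there exists $\gamma\in\Lambda$ such that $(\bar x,\bar u)$ is a bounded complete trajectory of the reduced limiting control system $\Sigma_\gamma$.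
   Context: **Switched system.** $\mathcal I=\{1,\dots,N\}$; $\mathcal X\subset\mathbb R^n$ is an open neighborhood of the origin. A switching signal is a function $\sigma:\mathbb R\to\mathcal I$ that is piecewise constant (finitely many jumps in each compact interval) and right-continuous; $\mathcal S$ is the set of all of them. Given $f:\mathbb R_{\ge0}\times\mathcal X\times\mathcal I\to\mathbb R^n$ and $h:\mathbb R_{\ge0}\times\mathcal X\times\mathcal I\to\mathbb R^p$, write $f_i(t,\xi)=f(t,\xi,i)$, $h_i(t,\xi)=h(t,\xi,i)$. The switched system with output is $\dot x(t)=f(t,x(t),\sigma(t))$, $y(t)=h(t,x(t),\sigma(t))$. Standing assumption: each $f_i,h_i$ is measurable in $t$ and continuous in $\xi$, and each $f_i$ satisfies the Carathéodory conditions (in addition, on each compact subset of $\mathbb R_{\ge0}\times\mathcal X$, $|f_i(t,\xi)|\le m(t)$ for some integrable $m$). A solution corresponding to $\sigma$ is a locally absolutely continuous $x:[t_0(x),t_f(x))\to\mathcal X$, $0\le t_0(x)<t_f(x)\le\infty$, with $\dot x(t)=f(t,x(t),\sigma(t))$ a.e.; it is maximal if it cannot be extended to a solution (for the same $\sigma$) on $[t_0(x),t')$ with $t'>t_f(x)$. A trajectory is a pair $(x,\sigma)$ with $\sigma\in\mathcal S$ and $x$ a maximal solution corresponding to $\sigma$. **Invariance.** $\chi=\{\chi_i\}_{i\in\mathcal I}$ is a closed covering of $\mathbb R^n$ if each $\chi_i$ is closed and $\bigcup_i\chi_i=\mathbb R^n$. $\mathcal T$ is invariant w.r.t. $\chi$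 if $x(t)\in\chi_{\sigma(t)}$ for all $(x,\sigma)\in\mathcal T$ and $t\in[t_0(x),t_f(x))$. Put $\mathcal I_\xi=\{i\in\mathcal I:\xi\in\chi_i\}$ and $U_\xi=\mathrm{co}\{e_i:i\in\mathcal I_\xi\}$, where $e_i$ is the $i$-th canonical vector of $\mathbb R^N$ and $\mathrm{co}$ is convex hull. **Controls.** $U=\{\mu\in\mathbb R_{\ge0}^N:\sum_i\mu_i=1\}$; $\mathcal U$ is the set of Lebesgue measurable $u:\mathbb R\to U$. A switching signal $\sigma$ is identified with the control $t\mapsto e_{\sigma(t)}$ in $\mathcal U$. For $u_k,u\in\mathcal U$, $u_k\rightharpoonup u$ means $\int_{\mathbb R}\varphi(t)'u_k(t)\,dt\to\int_{\mathbb R}\varphi(t)'u(t)\,dt$ for all $\varphi\in L^1(\mathbb R;\mathbb R^N)$. **Zeroing-output limiting trajectories.** A sequence $\{(t_k,x_k,\sigma_k)\}_{k\in\mathbb N}$ is a $\mathcal T$-zeroing-output sequence if $t_k\to\infty$, $(x_k,\sigma_k)\in\mathcal T$ for all $k$, and: (1) $t_0(x_k)\le t_k+t<t_f(x_k)$ for all $t\in[-k,k]$ and all $k$; (2) there are a compact $K\subset\mathcal X$ and $\varepsilon>0$ with $x_k(t_k+t)\in K$ and $|x_k(t_k+t)|\ge\varepsilon$ for all $t\in[-k,k]$ and all $k$; (3) $\lim_{k\to\infty}h(t_k+t,x_k(t_k+t),\sigma_k(t_k+t))=0$ for almost all $t\in\mathbb R$. A pair $(\bar x,\bar u)$, $\bar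 x:\mathbb R\to\mathcal X$, $\bar u\in\mathcal U$, is a limiting trajectory of $\mathcal T$ corresponding to a sequence $\{t_k\}$ in $\mathbb R_{\ge0}$ with $t_k\to\infty$ if there are a sequence $\{(x_k,\sigma_k)\}$ in $\mathcal T$ and a compact $K\subset\mathcal X$ such that: (1) $x_k(t)\in K$ for all $t\in[t_k-k,t_k+k]\subset[t_0(x_k),t_f(x_k))$ and all $k$, and $x_k(t_k+\cdot)\to\bar x$ uniformly on $[-T,T]$ for all $T>0$; (2) $\sigma_k(t_k+\cdot)\rightharpoonup\bar u$. If in addition $\{(t_k,x_k,\sigma_k)\}$ is a $\mathcal T$-zeroing-output sequence, $(\bar x,\bar u)$ is a $\mathcal T$-zeroing-output limiting trajectory. **Regularity notions.** For $g:J\times\mathcal X\to\mathbb R^m$, $J$ an interval: $g$ is uniformly bounded if there is $J'\subset J$ with $|J\setminus J'|=0$ such that $g$ is bounded on $J'\times K$ for each compact $K\subset\mathcal X$; measurable in $t$ if $g(\cdot,\xi)$ is Lebesgue measurable for all $\xi$; continuous in $\xi$ if $g(t,\cdot)$ is continuous for almost all $t$; continuous in $\xi$ uniformly in $t$ if there is $J'\subset J$ with $|J\setminus J'|=0$ such that for every compact $K\subset\mathcal X$ there is a continuous strictly increasing $\omega_K:\mathbb R_{\ge0}\to\mathbb R_{\ge0}$, $\omega_K(0)=0$, with $|g(t,\xi)-g(t,\zeta)|\le\omega_K(|\xi-\zeta|)$ for all $t\in J'$, $\xi,\zeta\in K$. For $g:\mathbb R_{\ge0}\times\mathcal X\to\mathbb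 R^m$, a sequence $\gamma=\{t_k\}$ of nonnegative times is admissible for $g$ if $t_k\to\infty$ and there are $g_\gamma:\mathbb R\times\mathcal X\to\mathbb R^m$ and a null set $E_\gamma\subset\mathbb R$ with $\lim_k g(t_k+s,\xi)=g_\gamma(s,\xi)$ for all $\xi\in\mathcal X$, $s\in\mathbb R\setminus E_\gamma$; $g_\gamma$ is the limiting function and $\Lambda(g)$ the set of admissible sequences. $g$ is precompact if every sequence $t_k\to\infty$ in $\mathbb R_{\ge0}$ has a subsequence in $\Lambda(g)$. A pair $(g,\hat g)$ of functions on $\mathbb R_{\ge0}\times\mathcal X$ is a zeroing pair if for every sequence $t_k\to\infty$ in $\mathbb R_{\ge0}$, compact $K\subset\mathcal X$, $\varepsilon>0$ and sequence $\{v_k\}$ in $K$ with $|v_k|\ge\varepsilon$ for all $k$: $g(t_k,v_k)\to0$ implies $\hat g(t_k,v_k)\to0$. **Reduced limiting control systems.** $\mathcal S_{\mathcal T}=\{\sigma\in\mathcal S:\exists x,\ (x,\sigma)\in\mathcal T\}$; $\mathcal S^*_{\mathcal T}$ is the set of $u\in\mathcal U$ for which there are $t_k\to\infty$ and $\sigma_k\in\mathcal S_{\mathcal T}$ with $\sigma_k(t_k+\cdot)\rightharpoonup u$. With the decomposition $f_i=\hat f_i+\Delta f_i$ fixed, $\Lambda=\bigcap_{i\in\mathcal I}[\Lambda(\hat f_i)\cap\Lambda(h_i)]$. For $\gamma\in\Lambda$ let $\hat F_\gamma=[\hat f_{1,\gamma}\cdots\hat f_{N,\gamma}]$ and $\hat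 H_\gamma=[|h_{1,\gamma}|\cdots|h_{N,\gamma}|]$. The reduced limiting control system is $$\Sigma_\gamma:\ \dot x=\hat F_\gamma(t,x)u,\quad y=\hat H_\gamma(t,x)u=0,\quad u(t)\in U_{x(t)},\ u\in\mathcal S^*_{\mathcal T}.$$ A complete trajectory of $\Sigma_\gamma$ is a pair $(x,u)$ with $x:\mathbb R\to\mathcal X$ locally absolutely continuous, $u\in\mathcal S^*_{\mathcal T}$ and, for almost all $t\in\mathbb R$, $u(t)\in U_{x(t)}$, $\dot x(t)=\hat F_\gamma(t,x(t))u(t)$, $\hat H_\gamma(t,x(t))u(t)=0$; it is bounded if $x(\mathbb R)$ is contained in a compact subset of $\mathcal X$. *)

(* Defs.v *)
From HB Require Import structures.
From mathcomp Require Import all_boot all_order all_algebra.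
From mathcomp Require Import all_classical all_reals all_analysis.

Set Implicit Arguments.
Unset Strict Implicit.
Unset Printing Implicit Defensive.

Import Order.TTheory GRing.Theory Num.Theory.
Import numFieldNormedType.Exports.

Local Open Scope classical_set_scope.
Local Open Scope ring_scope.

(* Conventions.
   - Functions that are only given on a subset of R or of R^n (such as
     f : R_{>=0} x X x I -> R^n) are total functions whose values elsewhere are
     never used: every definition below restricts times and states explicitly.
   - `|x| is the library norm of 'cV[R]_n (the sup norm); each notion below is
     unchanged if it is replaced by another norm, e.g. the Euclidean one.
   - "Lebesgue measurable", null sets and integrals refer to the completed
     Lebesgue measure. *)

(* R with the sigma-algebra of its Lebesgue-measurable sets, i.e., the domain
   of the completed Lebesgue measure. *)
Notation lebesgueTypeR R :=
  (caratheodory_type (mu_ext (wlength (@idfun R)))) (only parsing).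

Notation leb := (@completed_lebesgue_measure _) (only parsing).

Section analysis.
Context {R : realType}.

Definition lebesgue_measurable_fun {m : nat} (D : set R)
    (g : R -> 'cV[R]_m) : Prop :=
  forall j : 'I_m, @measurable_fun _ _ (lebesgueTypeR R) (measurableTypeR R)
    D (fun t => g t j ord0).

Definition absolutely_continuous {m : nat} (a b : R) (x : R -> 'cV[R]_m) :=
  forall eps : R, 0 < eps -> exists2 delta : R, 0 < delta &
    forall (q : nat) (l r : 'I_q -> R),
      (forall j, a <= l j /\ l j <= r j /\ r j <= b) ->
      trivIset setT (fun j => `]l j, r j[%classic) ->
      \sum_j (r j - l j) < delta ->
      \sum_j `|x (r j) - x (l j)| < eps.

(* For an interval D: absolute continuity on every compact subinterval of D. *)
Definition locally_absolutely_continuous {m : nat} (D : set R)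
    (x : R -> 'cV[R]_m) :=
  forall a b : R, `[a, b]%classic `<=` D -> absolutely_continuous a b x.

Definition convex_hull {m : nat} (A : set 'cV[R]_m) : set 'cV[R]_m :=
  smallest (@convex_set R 'cV[R]_m) A.

Definition nonneg_times : set R := `[0, +oo[%classic.

Definition times_to_infty (t_ : nat -> R) : Prop :=
  (forall k, 0 <= t_ k) /\ t_ @ \oo --> +oo.

End analysis.

Section regularity.
Context {R : realType} {n m : nat}.
Implicit Types (J : set R) (X : set 'cV[R]_n) (g : R -> 'cV[R]_n -> 'cV[R]_m).

Definition conegligible_in J (J' : set R) : Prop :=
  J' `<=` J /\ leb.-negligible (J `\` J').

Definition uniformly_bounded J X g : Prop :=
  exists2 J', conegligible_in J J' &
    forall K, compact K -> K `<=` X ->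
      exists M : R, forall t xi, J' t -> K xi -> `|g t xi| <= M.

Definition measurable_in_time J X g : Prop :=
  forall xi, X xi -> lebesgue_measurable_fun J (g ^~ xi).

Definition continuous_in_state J X g : Prop :=
  {ae leb, forall t : R, J t -> {within X, continuous (g t)}}.

Definition modulus_function (omega : R -> R) : Prop :=
  [/\ {within nonneg_times, continuous omega},
      (forall a b, 0 <= a -> a < b -> omega a < omega b) &
      omega 0 = 0].

Definition continuous_in_state_uniformly J X g : Prop :=
  exists2 J', conegligible_in J J' &
    forall K, compact K -> K `<=` X ->
      exists2 omega, modulus_function omega &
        forall t xi zeta, J' t -> K xi -> K zeta ->
          `|g t xi - g t zeta| <= omega `|xi - zeta|.

Definition caratheodory_conditions X g : Prop :=
  [/\ measurable_in_time nonneg_times X g,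
      continuous_in_state nonneg_times X g &
      forall C : set (R * 'cV[R]_n), compact C ->
        C `<=` nonneg_times `*` X ->
        exists2 bnd : R -> R,
          leb.-integrable nonneg_times (EFin \o bnd) &
          forall t xi, C (t, xi) -> `|g t xi| <= bnd t].

(* gl is a limiting function of g along gamma. The limiting function is only
   determined up to a null set of times. *)
Definition limiting_function X g (gamma : nat -> R)
    (gl : R -> 'cV[R]_n -> 'cV[R]_m) : Prop :=
  exists2 E : set R, leb.-negligible E &
    forall xi s, X xi -> ~ E s ->
      g (gamma k + s) xi @[k --> \oo] --> gl s xi.

(* The set Lambda(g). *)
Definition admissible X g : set (nat -> R) :=
  [set gamma | times_to_infty gamma /\
               exists gl, limiting_function X g gamma gl].

Definition precompact_in_time X g : Prop :=
  forall t_ : nat -> R, times_to_infty t_ ->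
    exists2 phi : nat -> nat, {homo phi : i j / (i < j)%N} &
      admissible X g (t_ \o phi).

End regularity.

Definition zeroing_pair {R : realType} {n m m' : nat} (X : set 'cV[R]_n)
    (g : R -> 'cV[R]_n -> 'cV[R]_m) (g' : R -> 'cV[R]_n -> 'cV[R]_m') : Prop :=
  forall (t_ : nat -> R) (K : set 'cV[R]_n) (eps : R) (v : nat -> 'cV[R]_n),
    times_to_infty t_ -> compact K -> K `<=` X -> 0 < eps ->
    (forall k, K (v k) /\ eps <= `|v k|) ->
    g (t_ k) (v k) @[k --> \oo] --> (0 : 'cV[R]_m) ->
    g' (t_ k) (v k) @[k --> \oo] --> (0 : 'cV[R]_m').

(* A function x : [t_0(x), t_f(x)) -> R^n. *)
Record curve (R : realType) (n : nat) := Curve {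
  curve_t0 : R;
  curve_tf : \bar R;
  curve_fun :> R -> 'cV[R]_n }.

Section switched_systems.
Context {R : realType} {n p N : nat}.
Implicit Types (X : set 'cV[R]_n) (sigma : R -> 'I_N) (x y : curve R n).
Implicit Types (f : R -> 'cV[R]_n -> 'I_N -> 'cV[R]_n).
Implicit Types (h : R -> 'cV[R]_n -> 'I_N -> 'cV[R]_p).
Implicit Types (T : set (curve R n * (R -> 'I_N))).

Definition curve_dom x : set R :=
  [set t | curve_t0 x <= t /\ (t%:E < curve_tf x)%E].

Definition jump sigma (t : R) : Prop := ~ \forall s \near t, sigma s = sigma t.

Definition switching_signal : set (R -> 'I_N) :=
  [set sigma |
    (forall a b : R, finite_set (`[a, b]%classic `&` jump sigma)) /\
    (forall t, \forall s \near t^'+, sigma s = sigma t)].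

Definition standing_assumption X f h : Prop :=
  forall i : 'I_N,
    [/\ caratheodory_conditions X (fun t xi => f t xi i),
        measurable_in_time nonneg_times X (fun t xi => h t xi i) &
        continuous_in_state nonneg_times X (fun t xi => h t xi i)].

Definition solution X f sigma x : Prop :=
  [/\ 0 <= curve_t0 x,
      ((curve_t0 x)%:E < curve_tf x)%E,
      (forall t, curve_dom x t -> X (x t)),
      locally_absolutely_continuous (curve_dom x) x &
      {ae leb, forall t : R, curve_dom x t ->
         is_derive (t : R) (1 : R) (curve_fun x) (f t (x t) (sigma t))}].

Definition maximal_solution X f sigma x : Prop :=
  solution X f sigma x /\
  ~ exists y, [/\ solution X f sigma y, curve_t0 y = curve_t0 x,
                  (curve_tf x < curve_tf y)%E &
                  forall t, curve_dom x t -> y t = x t].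

Definition trajectory X f : set (curve R n * (R -> 'I_N)) :=
  [set z | switching_signal z.2 /\ maximal_solution X f z.2 z.1].

Definition closed_covering (chi : 'I_N -> set 'cV[R]_n) : Prop :=
  (forall i, closed (chi i)) /\ \bigcup_i chi i = setT.

Definition invariant_wrt T (chi : 'I_N -> set 'cV[R]_n) : Prop :=
  forall x sigma, T (x, sigma) -> forall t, curve_dom x t -> chi (sigma t) (x t).

Definition canonical_vector (i : 'I_N) : 'cV[R]_N := delta_mx i ord0.

(* The set U_xi. *)
Definition control_set_at (chi : 'I_N -> set 'cV[R]_n) (xi : 'cV[R]_n) :
    set 'cV[R]_N :=
  convex_hull [set canonical_vector i | i in [set i | chi i xi]].

Definition simplex : set 'cV[R]_N :=
  [set mu | (forall i, 0 <= mu i ord0) /\ \sum_i mu i ord0 = 1].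

Definition controls : set (R -> 'cV[R]_N) :=
  [set u | lebesgue_measurable_fun setT u /\ forall t, simplex (u t)].

Definition control_of sigma : R -> 'cV[R]_N :=
  fun t => canonical_vector (sigma t).

Definition weakly_converges (u_ : nat -> R -> 'cV[R]_N) (u : R -> 'cV[R]_N) :=
  forall phi : R -> 'cV[R]_N,
    (forall i, leb.-integrable setT (fun t => (phi t i ord0)%:E)) ->
    \int[leb]_t ((phi t)^T *m u_ k t) ord0 ord0 @[k --> \oo] -->
    \int[leb]_t ((phi t)^T *m u t) ord0 ord0.

Definition zeroing_output_sequence X h T (t_ : nat -> R) (x_ : nat -> curve R n)
    (sigma_ : nat -> R -> 'I_N) : Prop :=
  [/\ t_ @ \oo --> +oo,
      (forall k, T (x_ k, sigma_ k)),
      (forall k t, - k%:R <= t <= k%:R -> curve_dom (x_ k) (t_ k + t)),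
      (exists (K : set 'cV[R]_n) (eps : R), [/\ compact K, K `<=` X, 0 < eps &
         forall k t, - k%:R <= t <= k%:R ->
           K (x_ k (t_ k + t)) /\ eps <= `|x_ k (t_ k + t)|]) &
      {ae leb, forall t : R,
         h (t_ k + t) (x_ k (t_ k + t)) (sigma_ k (t_ k + t)) @[k --> \oo]
           --> (0 : 'cV[R]_p)}].

(* (xbar, ubar) is a limiting trajectory of T corresponding to t_, as witnessed
   by the sequence (x_, sigma_) in T. *)
Definition limiting_trajectory_along X T (xbar : R -> 'cV[R]_n)
    (ubar : R -> 'cV[R]_N) (t_ : nat -> R) (x_ : nat -> curve R n)
    (sigma_ : nat -> R -> 'I_N) : Prop :=
  [/\ (forall t, X (xbar t)) /\ controls ubar,
      times_to_infty t_,
      (forall k, T (x_ k, sigma_ k)),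
      (exists K : set 'cV[R]_n, [/\ compact K, K `<=` X &
         forall k t, t_ k - k%:R <= t <= t_ k + k%:R ->
           curve_dom (x_ k) t /\ K (x_ k t)]) /\
      (forall S : R, 0 < S ->
         {uniform `[- S, S], (fun k t => x_ k (t_ k + t)) @ \oo --> xbar}) &
      weakly_converges (fun k t => control_of (sigma_ k) (t_ k + t)) ubar].

Definition zeroing_output_limiting_trajectory X h T (xbar : R -> 'cV[R]_n)
    (ubar : R -> 'cV[R]_N) : Prop :=
  exists (t_ : nat -> R) (x_ : nat -> curve R n) (sigma_ : nat -> R -> 'I_N),
    limiting_trajectory_along X T xbar ubar t_ x_ sigma_ /\
    zeroing_output_sequence X h T t_ x_ sigma_.

Definition signals_of T : set (R -> 'I_N) :=
  [set sigma | switching_signal sigma /\ exists x, T (x, sigma)].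

(* The set S^*_T. *)
Definition limiting_controls T : set (R -> 'cV[R]_N) :=
  [set u | controls u /\
    exists (t_ : nat -> R) (sigma_ : nat -> R -> 'I_N),
      [/\ t_ @ \oo --> +oo, (forall k, signals_of T (sigma_ k)) &
          weakly_converges (fun k t => control_of (sigma_ k) (t_ k + t)) u]].

(* The set Lambda. *)
Definition common_admissible X (fhat : R -> 'cV[R]_n -> 'I_N -> 'cV[R]_n) h :
    set (nat -> R) :=
  \bigcap_(i in [set: 'I_N])
    (admissible X (fun t xi => fhat t xi i) `&`
     admissible X (fun t xi => h t xi i)).

Definition Fhat (fl : R -> 'cV[R]_n -> 'I_N -> 'cV[R]_n) (t : R)
    (xi : 'cV[R]_n) : 'M[R]_(n, N) :=
  \matrix_(j, i) fl t xi i j ord0.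

Definition Hhat (hl : R -> 'cV[R]_n -> 'I_N -> 'cV[R]_p) (t : R)
    (xi : 'cV[R]_n) : 'rV[R]_N :=
  \row_i `|hl t xi i|.

(* Complete trajectories of the system Sigma_gamma built from the limiting
   functions fl i = \hat f_{i,gamma} and hl i = h_{i,gamma}. *)
Definition complete_trajectory X chi T fl hl (x : R -> 'cV[R]_n)
    (u : R -> 'cV[R]_N) : Prop :=
  [/\ (forall t, X (x t)),
      locally_absolutely_continuous setT x,
      limiting_controls T u &
      {ae leb, forall t : R,
         [/\ control_set_at chi (x t) (u t),
             is_derive (t : R) (1 : R) x (Fhat fl t (x t) *m u t) &
             Hhat hl t (x t) *m u t = 0]}].

Definition bounded_in X (x : R -> 'cV[R]_n) : Prop :=
  exists K : set 'cV[R]_n, [/\ compact K, K `<=` X & range x `<=` K].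

End switched_systems.

(* Main.v *)
Require Import Defs.
From mathcomp Require Import all_boot all_order all_algebra.
From mathcomp Require Import all_classical all_reals all_analysis.
From mathcomp Require Import measurable_realfun.
From mathcomp Require Import ring lra.
Import Order.TTheory GRing.Theory Num.Theory.
Import numFieldNormedType.Exports.
Local Open Scope classical_set_scope.
Local Open Scope ring_scope.
Set Implicit Arguments.
Unset Strict Implicit.
Unset Printing Implicit Defensive.

(** After passing to a subsequence gamma of the times t_k along which all hat f_i
    and h_i have limiting functions, work with the shifted trajectories
    y_k = x_k(gamma_k + .), which converge to xbar, and with the 0/1 indicators
    c_k^i of sigma_k(gamma_k + .) = i, which converge weakly to ubar_i.

    The zeroing property kills Delta f along the sequence, so
    y_k' - sum_i hat f_{i,gamma}(s, xbar(s)) c_k^i(s) tends to 0 almost everywhere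
    and boundedly. Integrating, by dominated convergence and weak convergence
    xbar(b) - xbar(a) = int_a^b sum_i hat f_{i,gamma}(s, xbar(s)) ubar_i(s) ds,
    and Lebesgue differentiation gives the differential equation.

    The output equation and the constraint ubar(t) in U_{xbar(t)} come from one
    principle: if eta >= 0 is bounded and eta c_k^i -> 0 almost everywhere, then
    eta ubar_i = 0 almost everywhere. Apply it to eta = |h_{i,gamma}(s, xbar(s))|
    componentwise, and to the indicator of the open set {s | xbar(s) notin chi_i}.

    All integration takes place for the Borel Lebesgue measure: each completed-measurable
    function that occurs is replaced by a Borel function equal to it almost everywhere. *)

(** * Completed and Borel Lebesgue measure *)

Section lebesgue_completion.
Context {R : realType}.
Notation mu := (@lebesgue_measure R).

(** A null set of the completed measure has outer measure zero, and outer measure zero yields a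
    Borel null cover. *)
Lemma leb_negligibleE (A : set R) : leb.-negligible A <-> mu.-negligible A.
Proof.
split=> [[B [mB B0 AB]]|[B [mB B0 AB]]].
  apply/negligible_outer_measure/eqP.
  by rewrite eq_le outer_measure_ge0 andbT -B0 le_outer_measure.
by exists B; split => //; exact: sub_caratheodory.
Qed.

Lemma ae_lebE (P : set R) : {ae leb, forall t, P t} <-> {ae mu, forall t, P t}.
Proof. exact: leb_negligibleE. Qed.

Lemma ae_imp (P Q : R -> Prop) : (forall t, P t -> Q t) ->
  {ae mu, forall t, P t} -> {ae mu, forall t, Q t}.
Proof. by move=> PQ; apply: negligibleS => t; apply: contra_not; exact: PQ. Qed.

Lemma ae_and (P Q : R -> Prop) : {ae mu, forall t, P t} ->
  {ae mu, forall t, Q t} -> {ae mu, forall t, P t /\ Q t}.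
Proof.
move=> aP aQ; apply: negligibleS (negligibleU aP aQ) => t /not_andP[nP|nQ].
  by left.
by right.
Qed.

Lemma negligible_bigcup_countable (I : countType) (F : I -> set R) :
  (forall i, mu.-negligible (F i)) -> mu.-negligible (\bigcup_i F i).
Proof.
move=> nF.
have : mu.-negligible
    (\bigcup_k (if @unpickle I k is Some i then F i else set0)).
  apply: negligible_bigcup => k; case: unpickle => // *.
  exact: negligible_set0.
by apply: negligibleS => t [i _ Fit]; exists (pickle i); rewrite ?pickleK.
Qed.

Lemma ae_countable (I : countType) (P : I -> R -> Prop) :
  (forall i, {ae mu, forall t, P i t}) -> {ae mu, forall t, forall i, P i t}.
Proof.
move=> aeP; apply: negligibleS (negligible_bigcup_countable aeP).
by move=> t /existsNP[i nP]; exists i.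
Qed.

(** Each superlevel set at a rational height is Borel up to a null set. The countably many
    exceptional sets fit into one Borel null set [Z], and [g] is replaced by 0 on it and outside
    [D]. *)
Lemma lebesgue_measurable_ae_Borel (D : set R) (g : R -> R) :
  measurable D ->
  @measurable_fun _ _ (lebesgueTypeR R) (measurableTypeR R) D g ->
  exists2 g' : R -> R, measurable_fun setT g' &
    {ae mu, forall t, D t -> g t = g' t}.
Proof.
move=> mD mg.
have mD' : @measurable _ (lebesgueTypeR R) D by exact: sub_caratheodory.
have H (q : rat) : exists AN : set R * set R,
    [/\ measurable AN.1, mu.-negligible AN.2 &
        D `&` g @^-1` `]ratr q, +oo[ = AN.1 `|` AN.2].
  have : (completed_algebra_gen mu).-sigma.-measurable
      (D `&` g @^-1` `]ratr q, +oo[).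
    by rewrite completed_caratheodory_measurable; exact: mg.
  by rewrite g_sigma_completed_algebra_genE => -[A mA [N nN] <-]; exists (A, N).
have {H}[AN H] := choice H.
have [Z [mZ Z0 NZ]] : mu.-negligible (\bigcup_(q : rat) (AN q).2).
  by apply: negligible_bigcup_countable => q; have [] := H q.
pose g' := g \_ (D `\` Z).
exists g'; last first.
  exists Z; split => // t /= /not_implyP[Dt gt]; apply: contrapT => nZt.
  by apply: gt; rewrite /g' patchE mem_set.
have mgq (q : rat) : measurable (g' @^-1` `]ratr q, +oo[).
  have [mA nN E] := H q.
  (* Off [D] minus [Z] the patch takes its default value 0, so that region belongs to the superlevel
     set exactly when [ratr q < 0]. *)
  rewrite (_ : _ @^-1` _ =
    ((AN q).1 `\` Z) `|` (~` (D `\` Z) `&` [set _ | (ratr q : R) < 0])); last first.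
    apply/seteqP; split => t /=.
      rewrite /g' patchE in_itv/= andbT; case: ifPn => [|].
        rewrite inE => -[Dt nZt] gt; left; split => //.
        have : (D `&` g @^-1` `]ratr q, +oo[) t by split => //=; rewrite in_itv/= gt.
        by rewrite E => -[//|Nt]; exfalso; apply: nZt; apply: NZ; exists q.
      by move=> /negP; rewrite inE => nD q0; right.
    rewrite /g' patchE in_itv/= andbT => -[[At nZt]|[nD q0]].
      have : (D `&` g @^-1` `]ratr q, +oo[) t by rewrite E; left.
      by move=> [Dt /=]; rewrite in_itv/= andbT mem_set.
    by rewrite memNset.
  apply: measurableU; first exact: measurableD.
  apply: measurableI; first by apply: measurableC; exact: measurableD.
  by case: (ltP (ratr q : R) 0) => _;
    [rewrite (_ : [set _ | _] = setT)// | rewrite (_ : [set _ | _] = set0)//];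
    apply/seteqP; split.
apply: (measurability _ (RGenOInfty.measurableE R)).
move=> _ [_ [x ->] <-]; rewrite setTI.
rewrite (_ : _ @^-1` _ =
  \bigcup_(q in [set q : rat | x < ratr q]) (g' @^-1` `]ratr q, +oo[)); last first.
  apply/seteqP; split => t /=.
    rewrite in_itv/= andbT => xt; have [q] := rat_in_itvoo xt.
    by rewrite in_itv/= => /andP[xq qt]; exists q => //=; rewrite in_itv/= qt.
  by move=> [q /= xq]; rewrite !in_itv/= !andbT; exact: lt_trans.
rewrite bigcup_mkcond; apply: bigcupT_measurable_rat => q.
by case: ifPn.
Qed.

Lemma negligible_translation (A : set R) (a : R) :
  mu.-negligible A -> mu.-negligible [set t | A (a + t)].
Proof.
move=> [B [mB B0 AB]].
pose phi : R -> R := fun t => a + t.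
have mphi : measurable_fun setT phi.
  by apply: continuous_measurable_fun => x; apply: cvgD; [exact: cvg_cst|exact: cvg_id].
exists (phi @^-1` B); split; [|idtac|by move=> t /AB].
  by rewrite -[X in measurable X]setTI; exact: mphi.
(* The pushforward of [mu] under the translation agrees with [mu] on half-open intervals, hence on
   all Borel sets. *)
rewrite -[LHS]/(pushforward mu (phi : measurableTypeR R -> measurableTypeR R) B).
rewrite -B0; apply/esym; apply: lebesgue_measure_unique => //= _ [[u v]] _ <-.
rewrite /pushforward (_ : phi @^-1` _ = `]u - a, v - a]%classic); last first.
  by apply/seteqP; split => t /=; rewrite !in_itv/= /phi ltrBlDl lerBrDl.
rewrite !lebesgue_measure_itv/= !lte_fin ltrD2r.
by case: ifP => // _; rewrite -!EFinD; congr EFin; ring.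
Qed.

(** The identity from the completed to the Borel sigma-algebra is measurable and pushes [leb]
    forward to [mu], so the change of variables formula applies. *)
Lemma Rintegral_leb (g : R -> R) : measurable_fun setT g ->
  mu.-integrable setT (EFin \o g) ->
  leb.-integrable setT (EFin \o g) /\ \int[leb]_t g t = \int[mu]_t g t.
Proof.
move=> mg ig.
pose phi : lebesgueTypeR R -> measurableTypeR R := idfun.
have mphi : measurable_fun setT phi.
  by move=> _ B mB; rewrite setTI; exact: sub_caratheodory.
have pE (A : set (measurableTypeR R)) : pushforward leb phi A = mu A by [].
have ig' : leb.-integrable setT (EFin \o g \o phi).
  move/integrableP : ig => [mEg gfin]; apply/integrableP; split.
    exact: measurableT_comp.
  move: gfin; rewrite (_ : (\int[mu]_x `|(EFin \o g) x|)%E =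
      (\int[pushforward leb phi]_x `|(EFin \o g) x|)%E)//.
  rewrite ge0_integral_pushforward//.
  exact: measurableT_comp.
split; first exact: ig'.
rewrite /Rintegral; congr fine.
have := integral_pushforward mphi (D := setT) (f := EFin \o g).
by move=> <-//; apply/measurable_EFinP.
Qed.

End lebesgue_completion.

(** * Absolutely continuous and Lipschitz functions *)

Section absolute_continuity.
Context {R : realType}.
Notation mu := (@lebesgue_measure R).

Lemma is_derive_locally_lipschitz (m : nat) (x : R -> 'cV[R]_m) (t M e : R) (d : 'cV[R]_m) :
  is_derive t (1 : R) x d -> `|d| <= M -> 0 < e ->
  exists2 r : R, 0 < r &
    forall s, `|s - t| < r -> `|x s - x t| <= (M + e) * `|s - t|.
Proof.
move=> [dx xd] dM e0.
have : h^-1 *: (x (h + t) - x t) @[h --> 0^'] --> d.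
  rewrite -xd; have := dx; rewrite /derivable => /cvg_ex[l xl].
  have -> : 'D_1 x t = l by apply/cvg_lim.
  by apply: cvg_trans xl; apply: near_eq_cvg; near=> h; rewrite /= [h *: 1]mulr1.
move/cvgrPdist_lt => /(_ _ e0) /nbhs_ballP[r /= r0 Hr].
exists r => // s sr; have [->|st] := eqVneq s t.
  by rewrite !subrr !normr0 mulr0.
have st0 : s - t != 0 by rewrite subr_eq0.
have := Hr (s - t).
rewrite /ball/= sub0r normrN => /(_ sr st0); rewrite subrK => H.
have -> : x s - x t = (s - t) *: ((s - t)^-1 *: (x s - x t)).
  by rewrite scalerA divff// scale1r.
rewrite normrZ mulrC ler_wpM2r//.
rewrite -[X in `|X|](subrK d) (le_trans (ler_normD _ _))// addrC lerD//.
by rewrite distrC ltW.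
Unshelve. all: by end_near. Qed.

(** Converts a measure bound on [W] into the bound on total length that absolute continuity asks
    for. *)
Lemma lebesgue_measure_disjoint_itvs (W : set R) (q : nat) (l r : nat -> R) :
  measurable W ->
  (forall j, (j < q)%N -> l j <= r j /\ `]l j, r j[ `<=` W) ->
  trivIset setT (fun j : 'I_q => `]l j, r j[%classic) ->
  ((\sum_(j < q) (r j - l j))%:E <= mu W)%E.
Proof.
move=> mW lrW tlr.
rewrite (_ : _%:E = mu (\big[setU/set0]_(j < q) `]l j, r j[%classic)); last first.
  rewrite measure_bigsetU_ord// -sumEFin; apply: eq_bigr => j _.
  apply/esym; apply: (etrans (lebesgue_measure_itv `]l j, r j[)) => /=.
  rewrite lte_fin; case: ltP => // rl.
  by have [lr _] := lrW j (ltn_ord j); rewrite (_ : r j = l j) ?subrr//; lra.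
rewrite le_measure ?inE//; first by apply: bigsetU_measurable => j _.
by rewrite -(bigcup_mkord q (fun j => `]l j, r j[%classic)) => t [j /= /lrW[_]]; apply.
Qed.

(* The exceptional null set lies in an open set W of measure < delta. A supremum
   argument in S below covers [a, b] by intervals on which either the derivative
   bound holds up to e, or which lie in W; the increments over the latter are
   controlled by absolute continuity. *)
Lemma absolutely_continuous_lipschitz (m : nat) (x d : R -> 'cV[R]_m) (a b M : R) :
  a <= b -> 0 <= M -> absolutely_continuous a b x ->
  {ae mu, forall t, a < t < b -> is_derive t (1 : R) x (d t) /\ `|d t| <= M} ->
  `|x b - x a| <= M * (b - a).
Proof.
move=> ab M0 acx aed; apply/ler_addgt0Pr => e0 e0_gt0.
(* The final error [e * (b - a) + e] equals [e0]; the added 1 keeps the denominator positive when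
   [a = b]. *)
pose e := e0 / (b - a + 1).
have e_gt0 : 0 < e by rewrite divr_gt0//; lra.
suff H : `|x b - x a| <= (M + e) * (b - a) + e.
  have ee : e * (b - a + 1) = e0 by rewrite /e divfK// gt_eqF//; lra.
  by apply: (le_trans H); rewrite -ee; lra.
have [delta delta0 ac] := acx e e_gt0.
pose Z := ~` [set t | a < t < b -> is_derive t (1 : R) x (d t) /\ `|d t| <= M].
have nZ : mu.-negligible Z := aed.
(* The endpoints are put into [W] because differentiability is known only strictly between them. *)
have [W [oW ZO Odelta]] : exists W : set R, [/\ open W, Z `|` [set a; b] `<=` W
    & (mu W < delta%:E)%E].
  have /negligible_outer_measure Z0 : mu.-negligible (Z `|` [set a; b]).
    apply: negligibleU => //; apply: negligibleU;
    by apply/negligibleP => //; exact: lebesgue_measure_set1.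
  have [|W [oW ZO Oe]] := outer_measure_open_le (Z `|` [set a; b]) (e := delta / 2).
    by rewrite divr_gt0.
  exists W; split => //; apply: (le_lt_trans Oe).
  rewrite [X in (X + _)%E]Z0.
  by rewrite add0e lte_fin; lra.
have mW : measurable W by exact: open_measurable.
pose S : set R := [set s | a <= s <= b /\ exists (q : nat) (l r : nat -> R),
  [/\ forall j, (j < q)%N -> [/\ a <= l j, l j <= r j, r j <= s &
                                `]l j, r j[%classic `<=` W],
      forall i j, (i < j < q)%N -> r i <= l j &
      `|x s - x a| <= (M + e) * (s - a) + \sum_(j < q) `|x (r j) - x (l j)|] ].
have Me0 : 0 <= M + e by lra.
(* A step from [u] to [v] either increases the linear term or appends []u, v[] as the interval of
   index [q]. *)
have step u v : S u -> u <= v <= b ->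
    `|x v - x u| <= (M + e) * (v - u) \/ `]u, v[%classic `<=` W -> S v.
  move=> [/andP[au ub] [q [l [r [lrW lr xs]]]]] /andP[uv vb].
  have avb : a <= v <= b by apply/andP; split; lra.
  have xva : `|x v - x a| <= `|x v - x u| + `|x u - x a|.
    by rewrite -[x v - x a](subrKA (x u)) ler_normD.
  case=> [xvu|uvW]; split => //.
    exists q, l, r; split => //.
      by move=> j /lrW[? ? ? ?]; split => //; lra.
    apply: (le_trans xva); nra.
  exists q.+1, (fun j => if j == q then u else l j),
    (fun j => if j == q then v else r j); split.
  - move=> j; rewrite ltnS leq_eqVlt; case: eqVneq => [->//|jq /= /lrW[? ? ? ?]].
    by split => //; lra.
  - move=> i j /andP[ij jq]; rewrite (ltn_eqF (leq_trans ij jq)).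
    have [jE|/negbTE jE] := eqVneq j q; last first.
      by apply: lr; rewrite ij ltn_neqAle jE -ltnS.
    by have [] := lrW i _; rewrite -?jE.
  - rewrite big_ord_recr/= eqxx.
    rewrite (eq_bigr (fun j : 'I_q => `|x (r j) - x (l j)|)); last first.
      by move=> j _; rewrite ltn_eqF.
    apply: (le_trans xva); move: xs; set A := \sum_(_ < _) _ => xs.
    have : (M + e) * (u - a) <= (M + e) * (v - a) by rewrite ler_wpM2l//; lra.
    lra.
have Sa : S a.
  split; first by rewrite lexx.
  exists 0%N, (fun=> 0), (fun=> 0); split => //.
  by rewrite !subrr normr0 mulr0 big_ord0 addr0.
have Sub : ubound S b by move=> s [/andP[]].
have hS : has_sup S by split; [exists a|exists b].
pose c := sup S.
have cb : c <= b by apply: ge_sup => //; exists a.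
have ac' : a <= c by apply: ub_le_sup => //; exists b.
(* Every short interval around [c] is an admissible step: it lies in [W] when [c] does, and
   otherwise the derivative at [c] bounds the increments on both sides of [c]. *)
have [rho rho0 Hrho] : exists2 rho, 0 < rho & forall u v, c - rho < u -> u <= c -> c <= v ->
    v < c + rho -> `|x v - x u| <= (M + e) * (v - u) \/ `]u, v[%classic `<=` W.
  have [Oc|nOc] := pselect (W c).
    have /nbhs_ballP[rho /= rho0 Hrho] := open_nbhs_nbhs (conj oW Oc).
    exists rho => // u v cu uc cv vc; right => t /=; rewrite in_itv/= => /andP[ut tv].
    apply: Hrho; rewrite /ball/= ltr_norml; apply/andP; split; lra.
  have acb : a < c < b.
    rewrite !lt_neqAle cb ac' !andbT.
    by apply/andP; split; apply/eqP => E; apply: nOc; apply: ZO; right => /=;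
      [left; exact: esym|right].
  have [dc dM] : is_derive c (1 : R) x (d c) /\ `|d c| <= M.
    by apply: contrapT => nd; apply: nOc; apply: ZO; left; rewrite /Z/= => /(_ acb).
  have [rho rho0 Hrho] := is_derive_locally_lipschitz dc dM e_gt0.
  exists rho => // u v cu uc cv vc; left.
  have -> : x v - x u = (x v - x c) - (x u - x c) by rewrite opprB addrA subrK.
  rewrite (le_trans (ler_normB _ _))//.
  have Hv : `|v - c| = v - c by rewrite ger0_norm// subr_ge0.
  have Hu : `|u - c| = c - u by rewrite distrC ger0_norm// subr_ge0.
  have := Hrho v; have := Hrho u; rewrite Hv Hu => H1 H2.
  have {}H1 : `|x u - x c| <= (M + e) * (c - u) by apply: H1; lra.
  have {}H2 : `|x v - x c| <= (M + e) * (v - c) by apply: H2; lra.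
  by lra.
have [u Su cu] := sup_adherent rho0 hS.
have uc : u <= c by apply: ub_le_sup => //; exists b.
have Sc : S c.
  apply: (step u) => //; first by rewrite uc.
  by apply: Hrho => //; lra.
have cbE : c = b.
  apply/eqP; rewrite eq_le cb /= leNgt; apply/negP => cb'.
  (* If [c < b], one more step beyond [c] contradicts the choice of [c] as a supremum. *)
  pose v := Num.min b (c + rho / 2).
  have cv : c < v by rewrite /v lt_min cb'/= ltrDl; lra.
  have vb : v <= b by rewrite /v ge_min lexx.
  have vr : v <= c + rho / 2 by rewrite /v ge_min lexx orbT.
  have : S v.
    apply: (step c) => //; first by rewrite vb (ltW cv).
    by apply: Hrho => //; lra.
  by move/(ub_le_sup (ex_intro _ b Sub)); rewrite leNgt cv.
move: Sc; rewrite cbE => -[_ [q [l [r [lrW lr xs]]]]].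
(* With [c = b], the intervals collected in [W] are disjoint of total length below [delta], so
   absolute continuity bounds their increments by [e]. *)
have tlr : trivIset setT (fun j : 'I_q => `]l j, r j[%classic).
  apply/trivIsetP => i j _ _ ij; wlog ij' : i j ij / (i < j)%N.
    move=> wlg; have [|ji] := ltnP i j; first exact: wlg.
    by rewrite setIC wlg// 1?eq_sym// ltn_neqAle ji eq_sym andbT.
  have := lr i j; rewrite ij' ltn_ord => /(_ isT) rl.
  apply/seteqP; split => // t [] /=; rewrite !in_itv/= => /andP[_ tr] /andP[lt _].
  by lra.
apply: (le_trans xs); rewrite lerD2l ltW//.
apply: (ac q (fun j => l j) (fun j => r j)) => //.
  by move=> j; have [] := lrW j (ltn_ord j).
rewrite -lte_fin; apply: le_lt_trans Odelta.
by apply: lebesgue_measure_disjoint_itvs => // j /lrW[].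
Qed.

End absolute_continuity.

(** * Bounded convergence and the fundamental theorem of calculus for Lipschitz functions *)

Section bounded_convergence.
Context {R : realType}.
Notation mu := (@lebesgue_measure R).

Lemma bounded_measurable_integrable (a b M : R) (g : R -> R) :
  measurable_fun setT g -> (forall t, `|g t| <= M) ->
  mu.-integrable `[a, b] (EFin \o g).
Proof.
move=> mg gM; apply: measurable_bounded_integrable => //.
- apply: (@eq_ind_r _ _ (fun z => (z < +oo)%E) _ _ (lebesgue_measure_itv `[a, b])) => /=.
  by case: ifP => // _; rewrite -EFinD ltry.
- exact: measurable_funTS.
- exists M; split; first exact: num_real.
  by move=> x Mx t _; rewrite /= (le_trans (gM t))// ltW.
Qed.

(** The upper limit of the [G k] is Borel on the whole line and agrees with [g] wherever the
    convergence holds; truncation at [M] makes the bound immediate everywhere. *)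
Lemma ae_cvg_Borel (A : set R) (M : R) (G : nat -> R -> R) (g : R -> R) :
  0 <= M -> (forall k, measurable_fun setT (G k)) ->
  (forall k t, `|G k t| <= M) ->
  {ae mu, forall t, A t -> G k t @[k --> \oo] --> g t} ->
  exists D : R -> R, [/\ measurable_fun setT D, (forall t, `|D t| <= M) &
    {ae mu, forall t, A t -> D t = g t}].
Proof.
move=> M0 mG GM Gg.
pose h t := limn_sup (G ^~ t).
have mh : measurable_fun setT h.
  apply: measurable_fun_limn_sup => // t _.
    by exists M => _ [k _ <-]; rewrite (le_trans (ler_norm _)).
  by exists (- M) => _ [k _ <-]; have := GM k t; rewrite ler_norml => /andP[].
exists (fun t => Num.max (- M) (Num.min M (h t))); split.
- apply: measurable_maxr; first exact: measurable_cst.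
  by apply: measurable_minr => //; exact: measurable_cst.
- by move=> t; rewrite ler_norml le_max lexx /= ge_max ge_min lexx /= andbT; lra.
- apply: ae_imp Gg => t + At => /(_ At) Gt.
  have -> : h t = g t by rewrite /h (cvg_limn_inf_sup Gt).
  have : - M <= g t <= M.
    rewrite -ler_norml -(cvg_lim _ (cvg_norm Gt))//.
    apply: limr_le; first by apply: is_cvg_norm; apply/cvg_ex; exists (g t).
    exact: nearW.
  by move=> /andP[? ?]; rewrite min_r// max_r.
Qed.

Lemma Rintegral_bounded_cvg (a b M : R) (G : nat -> R -> R) (g : R -> R) :
  (forall k, measurable_fun setT (G k)) -> measurable_fun setT g ->
  (forall k t, `|G k t| <= M) ->
  {ae mu, forall t, a < t < b -> G k t @[k --> \oo] --> g t} ->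
  \int[mu]_(t in `[a, b]) G k t @[k --> \oo] --> \int[mu]_(t in `[a, b]) g t.
Proof.
move=> mG mg GM Gg.
have [H0 _ H] : [/\ mu.-integrable `[a, b] (EFin \o g),
   (\int[mu]_(t in `[a, b]) `|(G k t)%:E - (g t)%:E|)%E @[k --> \oo] --> 0%E &
   (\int[mu]_(t in `[a, b]) (G k t)%:E)%E @[k --> \oo] --> (\int[mu]_(t in `[a, b]) (g t)%:E)%E].
  apply: (@dominated_convergence _ _ R mu `[a, b]%classic _
    (fun k t => (G k t)%:E) (EFin \o g) (fun=> M%:E)).
  - exact: measurable_itv.
  - by move=> k; apply/measurable_EFinP; apply: measurable_funTS; exact: mG.
  - by apply/measurable_EFinP; apply: measurable_funTS; exact: mg.
  (* Convergence is given on the open interval only; the two endpoints form a null set. *)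
  - have ae_ab : {ae mu, forall t, t != a /\ t != b}.
      have : mu.-negligible ([set a] `|` [set b]).
        apply: negligibleU; apply/negligibleP => //; exact: lebesgue_measure_set1.
      apply: negligibleS => t /= /not_andP[|] /negP; rewrite negbK => /eqP ->; by [left|right].
    apply: ae_imp (ae_and Gg ae_ab) => t [H [ta tb]] /=; rewrite in_itv/= => /andP[at' tb'].
    apply: cvg_EFin; first exact: nearW.
    by apply: H; rewrite !lt_neqAle eq_sym ta tb at' tb'.
  - apply: (@bounded_measurable_integrable a b `|M| (fun=> M)) => //.
  - by apply: nearW => t k _ /=; rewrite lee_fin.
rewrite /Rintegral; apply: fine_cvg; rewrite fineK//.
exact: integrable_fin_num H0.
Qed.

Lemma is_derive_difference_quotients (y : R -> R) (t d : R) :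
  is_derive t (1 : R) y d ->
  k.+1%:R * (y (t + k.+1%:R^-1) - y t) @[k --> \oo] --> d.
Proof.
move=> [dy yd].
have : h^-1 *: (y (h + t) - y t) @[h --> 0^'] --> d.
  rewrite -yd; have := dy; rewrite /derivable => /cvg_ex[l yl].
  have -> : 'D_1 y t = l by apply/cvg_lim.
  by apply: cvg_trans yl; apply: near_eq_cvg; near=> h; rewrite /= [h *: 1]mulr1.
move/cvgr_dnbhsP => /(_ (fun k => k.+1%:R^-1)).
move=> H; have {}H := H (conj _ _).
have -> : (fun k => k.+1%:R * (y (t + k.+1%:R^-1) - y t)) =
    (fun k => k.+1%:R^-1^-1 *: (y (k.+1%:R^-1 + t) - y t)).
  by apply/funext => k; rewrite invrK (addrC t).
apply: H; last exact: cvg_harmonic.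
by move=> k; rewrite invr_eq0 pnatr_eq0.
Unshelve. all: by end_near.
Qed.

Lemma is_derive_translation (V : normedModType R) (x : R -> V) (s c : R) (d : V) :
  is_derive (s + c) (1 : R) x d -> is_derive s (1 : R) (fun t => x (t + c)) d.
Proof.
have E : (fun h : R => h^-1 *: (((fun t => x (t + c)) \o shift s) (h *: 1) - x (s + c))) =
    (fun h : R => h^-1 *: ((x \o shift (s + c)) (h *: 1) - x (s + c))).
  by apply/funext => h /=; rewrite addrA.
move=> [dx xd]; split; first by rewrite /derivable E.
by rewrite -xd /derive E.
Qed.

Lemma is_derive_integral (Y : R -> R) (a M s : R) :
  continuous Y -> (forall t, `|Y t| <= M) -> a < s ->
  is_derive s (1 : R) (fun z => \int[mu]_(t in `[a, z]) Y t) (Y s).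
Proof.
move=> cY YM as_.
have mY : measurable_fun setT Y by exact: continuous_measurable_fun.
have [] := @continuous_FTC1_closed R Y a s (s + 1) _
  (bounded_measurable_integrable _ _ mY YM) as_ (cY s).
  by rewrite ltrDl.
by move=> dP PE; apply: DeriveDef; [exact: dP|rewrite -PE derive1E].
Qed.

(** The integrand is the derivative of a rescaled increment of the antiderivative [P]. Starting [P]
    at [a - 1] makes it differentiable from both sides at [a]. *)
Lemma continuous_integral_difference (Y : R -> R) (a b M : R) (k : nat) :
  a < b -> continuous Y -> (forall t, `|Y t| <= M) ->
  let P s := \int[mu]_(t in `[a - 1, s]) Y t in
  \int[mu]_(t in `[a, b]) (k.+1%:R * (Y (t + k.+1%:R^-1) - Y t)) =
  k.+1%:R * (P (b + k.+1%:R^-1) - P b) - k.+1%:R * (P (a + k.+1%:R^-1) - P a).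
Proof.
move=> ab cY YM P.
have dP s : a - 1 < s -> is_derive s (1 : R) P (Y s) by exact: is_derive_integral.
pose dl : R := k.+1%:R^-1.
have dl0 : 0 < dl by rewrite invr_gt0.
pose F s := k.+1%:R * (P (s + dl) - P s).
have dF s : a - 1 < s -> is_derive s (1 : R) F (k.+1%:R * (Y (s + dl) - Y s)).
  move=> as_.
  have d1 := dP _ as_.
  have d2 : is_derive (s + dl) (1 : R) P (Y (s + dl)) by apply: dP; lra.
  have d3 : is_derive s (1 : R) (P \o shift dl) (Y (s + dl)).
    exact: is_derive_translation.
  have -> : F = k.+1%:R \*: ((P \o shift dl) - P) by [].
  exact: is_deriveZ.
have cF s : a - 1 < s -> {for s, continuous F}.
  by move=> /dF[dF' _]; apply/differentiable_continuous/derivable1_diffP.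
rewrite /Rintegral (@continuous_FTC2 _ _ F)//.
- apply: continuous_subspaceT => s; apply: cvgM; first exact: cvg_cst.
  apply: cvgB; last exact: cY.
  by apply: (continuous_comp (f := fun s => s + dl));
    [apply: cvgD; [exact: cvg_id|exact: cvg_cst]|exact: cY].
- split.
  + by move=> s; rewrite in_itv/= => /andP[as_ _]; have [] := dF s _; [lra|].
  + by apply: cvg_at_right_filter; apply: cF; lra.
  + by apply: cvg_at_left_filter; apply: cF; lra.
- move=> s; rewrite in_itv/= => /andP[as_ _].
  by rewrite derive1E; have [] := dF s _; [lra|].
Qed.

Lemma clamp_contraction (a b s t : R) :
  `|Num.max a (Num.min b s) - Num.max a (Num.min b t)| <= `|s - t|.
Proof.
have maxC (u v w : R) : `|Num.max u v - Num.max u w| <= `|v - w|.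
  wlog vw : v w / v <= w.
    by move=> H; have /orP[/H//|/H] := le_total v w; rewrite distrC (distrC w).
  rewrite distrC (distrC v) [leRHS]ger0_norm ?subr_ge0// ger0_norm; last first.
    by rewrite subr_ge0 ge_max !le_max lexx vw orbT.
  have : u <= Num.max u v by rewrite le_max lexx.
  have : v <= Num.max u v by rewrite le_max lexx orbT.
  by rewrite lerBlDr ge_max => *; apply/andP; split; lra.
have minC (u v w : R) : `|Num.min u v - Num.min u w| <= `|v - w|.
  wlog vw : v w / v <= w.
    by move=> H; have /orP[/H//|/H] := le_total v w; rewrite distrC (distrC w).
  rewrite distrC (distrC v) [leRHS]ger0_norm ?subr_ge0// ger0_norm; last first.
    by rewrite subr_ge0 le_min !ge_min lexx vw orbT.
  have : Num.min u w <= u by rewrite ge_min lexx.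
  have : Num.min u w <= w by rewrite ge_min lexx orbT.
  by rewrite lerBlDr -lerBlDl le_min => *; apply/andP; split; lra.
exact: le_trans (maxC _ _ _) (minC _ _ _).
Qed.

(* D is the almost everywhere limit of the difference quotients of the extension Y
   of y by constants, whose integrals are differences of difference quotients of an
   antiderivative of Y. *)
Lemma lipschitz_FTC (y d : R -> R) (a b M : R) :
  a < b -> 0 <= M ->
  (forall s t, a <= s <= b -> a <= t <= b -> `|y s - y t| <= M * `|s - t|) ->
  {ae mu, forall t, a < t < b -> is_derive t (1 : R) y (d t)} ->
  exists D : R -> R, [/\ measurable_fun setT D, (forall t, `|D t| <= M),
    {ae mu, forall t, a < t < b -> D t = d t} &
    \int[mu]_(t in `[a, b]) D t = y b - y a].
Proof.
move=> ab M0 lipy aed.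
pose clamp (t : R) := Num.max a (Num.min b t).
have clampP t : a <= clamp t <= b.
  by rewrite le_max lexx/= ge_max (ltW ab) ge_min lexx.
have clampE t : a <= t <= b -> clamp t = t.
  by move=> /andP[at' tb]; rewrite /clamp min_r// max_r.
have clampD s t : `|clamp s - clamp t| <= `|s - t| by exact: clamp_contraction.
(* [Y] is [M]-Lipschitz on the whole line, so its forward quotients are bounded by [M] even when
   their right end exceeds [b]. *)
pose Y t := y (clamp t).
have lipY s t : `|Y s - Y t| <= M * `|s - t|.
  by rewrite (le_trans (lipy _ _ _ _))// ler_wpM2l.
have cY : continuous Y.
  move=> t; apply/cvgrPdist_le => e e0; near=> s.
  rewrite (le_trans (lipY _ _))//.
  have : `|t - s| <= e / (M + 1).
    near: s; apply: cvgr_dist_le; [exact: cvg_id|].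
    by rewrite divr_gt0//; lra.
  rewrite ler_pdivlMr; last lra.
  have := normr_ge0 (t - s); nra.
have YM t : `|Y t| <= `|y a| + M * (b - a).
  rewrite -[Y t](subrK (y a)) (le_trans (ler_normD _ _))// addrC lerD2l.
  have /andP[h1 h2] := clampP t.
  rewrite (le_trans (lipy _ _ _ _))// ?lexx ?(ltW ab)//.
  by rewrite ler_wpM2l// ger0_norm; lra.
pose Q k t := k.+1%:R * (Y (t + k.+1%:R^-1) - Y t).
have mQ k : measurable_fun setT (Q k).
  apply: continuous_measurable_fun => s; apply: cvgM; first exact: cvg_cst.
  apply: cvgB; last exact: cY.
  by apply: (continuous_comp (f := fun s => s + _));
    [apply: cvgD; [exact: cvg_id|exact: cvg_cst]|exact: cY].
have QM k t : `|Q k t| <= M.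
  have k0 : (0 : R) < k.+1%:R by [].
  rewrite normrM gtr0_norm// (le_trans (ler_wpM2l _ (lipY _ _)))//.
  rewrite addrAC subrr add0r gtr0_norm ?invr_gt0//.
  by rewrite mulrCA divff ?mulr1// gt_eqF.
have aeQ : {ae mu, forall t, a < t < b -> Q k t @[k --> \oo] --> d t}.
  apply: ae_imp aed => t H /[dup] /andP[at' tb] /H /is_derive_difference_quotients.
  have bt : 0 < b - t by rewrite subr_gt0.
  apply: cvg_trans; apply: near_eq_cvg; near=> k.
  (* Once [k.+1%:R^-1 <= b - t], both arguments lie in [[a, b]] and clamping changes nothing. *)
  rewrite /Q /Y !clampE//; [by apply/andP; split; exact: ltW|].
  have : k.+1%:R^-1 <= b - t.
    near: k; apply: filterS (near_infty_natSinv_lt (PosNum bt)) => k /=.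
    exact: ltW.
  have : 0 < k.+1%:R^-1 :> R by rewrite invr_gt0.
  by move: (k.+1%:R^-1) => z z0 zbt; apply/andP; split; lra.
have [D [mD DM Dd]] := ae_cvg_Borel M0 mQ QM aeQ.
exists D; split => //.
have QD : {ae mu, forall t, a < t < b -> Q k t @[k --> \oo] --> D t}.
  by apply: ae_imp (ae_and aeQ Dd) => t [H1 H2] atb; rewrite H2//; exact: H1.
(* The integrals of [Q k] tend to that of [D]; by uniqueness of limits it remains to see that they
   tend to [y b - y a]. *)
have := Rintegral_bounded_cvg mQ mD QM QD.
move/(@cvg_unique _ _ _ _ _ _ ); apply => //.
rewrite /=.
under eq_fun do rewrite (continuous_integral_difference _ ab cY YM).
have -> : y b = Y b by rewrite /Y clampE// lexx (ltW ab).
have -> : y a = Y a by rewrite /Y clampE// lexx (ltW ab).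
have dP s : a - 1 < s -> _ := is_derive_integral cY YM.
have db := is_derive_difference_quotients (dP b _).
have da := is_derive_difference_quotients (dP a _).
by apply: (cvgB (db _) (da _)); lra.
Unshelve. all: by end_near.
Qed.

End bounded_convergence.

(** * Componentwise limits and derivatives of column vectors *)

Section column_vectors.
Context {R : realType}.

Lemma norm_coord_le (m : nat) (v : 'cV[R]_m) (j : 'I_m) : `|v j ord0| <= `|v|.
Proof.
rewrite [leRHS]/Num.norm/= mx_normrE.
exact: (le_bigmax _ (fun ij => `|v ij.1 ij.2|) (j, ord0)).
Qed.

Lemma cvg_coord (m : nat) (u : nat -> 'cV[R]_m) (v : 'cV[R]_m) (j : 'I_m) :
  u k @[k --> \oo] --> v -> u k j ord0 @[k --> \oo] --> v j ord0.
Proof.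
move=> uv; apply/cvgrPdist_lt => e e0.
near=> k; apply: (@le_lt_trans _ _ `|v - u k|); last first.
  by near: k; exact: cvgr_dist_lt.
by have := norm_coord_le (v - u k) j; rewrite !mxE.
Unshelve. all: by end_near.
Qed.

Lemma is_derive_coord (m : nat) (x : R -> 'cV[R]_m) (t : R) (d : 'cV[R]_m) (j : 'I_m) :
  is_derive t (1 : R) x d -> is_derive t (1 : R) (fun s => x s j ord0) (d j ord0).
Proof.
move=> [dx <-]; split; first exact: ((@derivable_mxP R R m 1 x t 1).1 dx).
by rewrite (@derive_mx R R m 1 x t 1 dx) mxE.
Qed.

Lemma is_derive_col (m : nat) (x : R -> 'cV[R]_m) (t : R) (d : 'cV[R]_m) :
  (forall j, is_derive t (1 : R) (fun s => x s j ord0) (d j ord0)) ->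
  is_derive t (1 : R) x d.
Proof.
move=> dj.
have dx : derivable x t 1.
  by apply: (@derivable_mxP R R m 1 x t 1).2 => i j; rewrite ord1; have [] := dj i.
split => //; rewrite (@derive_mx R R m 1 x t 1 dx); apply/colP => j; rewrite mxE.
by have [_] := dj j.
Qed.

End column_vectors.

(** * Limiting functions along convergent curves *)

Section limiting_functions.
Context {R : realType}.
Notation mu := (@lebesgue_measure R).

Lemma times_to_infty_near (gam : nat -> R) (s : R) : times_to_infty gam ->
  \forall k \near \oo, 0 <= gam k + s.
Proof.
move=> [_ /cvgryPge /(_ (- s))]; apply: filterS => k.
by rewrite -subr_ge0 opprK.
Qed.

Lemma modulus_function_near0 (omega : R -> R) (e : R) : modulus_function omega -> 0 < e ->
  exists2 d : R, 0 < d & forall r, 0 <= r < d -> omega r < e.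
Proof.
move=> [/subspace_continuousP co _ o0] e0.
have := co 0; rewrite /nonneg_times/= in_itv/= lexx => /(_ isT).
move/cvgrPdist_lt => /(_ _ e0); rewrite /prop_near1 /= => H.
have /nbhs_ballP[d /= d0 Hd] :
    nbhs (0 : R) [set t | nonneg_times t -> `|omega 0 - omega t| < e] := H.
exists d => // r /andP[r0 rd].
have := Hd r; rewrite /ball/= sub0r normrN ger0_norm// => /(_ rd).
rewrite /nonneg_times/= in_itv/= r0 => /(_ isT).
by rewrite o0 sub0r normrN; apply: le_lt_trans; exact: ler_norm.
Qed.

Lemma ae_translation (a : R) (P : R -> Prop) :
  {ae mu, forall t, P t} -> {ae mu, forall t, P (a + t)}.
Proof. exact: negligible_translation. Qed.

(** The countably many translates of the exceptional set are null, which gives one null set valid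
    for all [k] at once. *)
Lemma ae_conegligible (J' : set R) (gam : nat -> R) :
  conegligible_in nonneg_times J' ->
  {ae mu, forall s, forall k, 0 <= gam k + s -> J' (gam k + s)}.
Proof.
move=> [_ /leb_negligibleE nJ]; apply: ae_countable => k.
apply: (@ae_translation (gam k) (fun t => 0 <= t -> J' t)).
apply: negligibleS nJ => t /= /not_implyP[t0 nJt]; split => //.
by rewrite /nonneg_times/= in_itv/= t0.
Qed.

(** The modulus on [K] controls the replacement of [y k s] by [z s]. The null set of a limiting
    function is common to all states, so the state may then be taken as [z s], depending on [s]. *)
Lemma limiting_function_along (n m : nat) (X K : set 'cV[R]_n)
    (g : R -> 'cV[R]_n -> 'cV[R]_m) (gam : nat -> R) gl
    (y : nat -> R -> 'cV[R]_n) (z : R -> 'cV[R]_n) :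
  times_to_infty gam -> continuous_in_state_uniformly nonneg_times X g ->
  limiting_function X g gam gl -> compact K -> K `<=` X ->
  (forall s, K (z s)) -> (forall s, \forall k \near \oo, K (y k s)) ->
  (forall s, y k s @[k --> \oo] --> z s) ->
  {ae mu, forall s, g (gam k + s) (y k s) @[k --> \oo] --> gl s (z s)}.
Proof.
move=> gamy [J' J'c Hw] [E nE Hl] cK KX Kz Ky yz.
have [omega om Hom] := Hw K cK KX.
have aeE : {ae mu, forall s, ~ E s}.
  have /leb_negligibleE nE' := nE.
  by apply: negligibleS nE' => s /= /contrapT.
apply: ae_imp (ae_and (ae_conegligible gam J'c) aeE) => s [Js Es].
apply/cvgrPdist_lt => e e0.
have e2 : 0 < e / 2 by rewrite divr_gt0.
have [d d0 omd] := modulus_function_near0 om e2.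
near=> k.
have J'k : J' (gam k + s) by apply: Js; near: k; exact: times_to_infty_near.
rewrite (splitr e) -(subrKA (g (gam k + s) (z s))) (le_lt_trans (ler_normD _ _))//.
rewrite ltrD//.
  by near: k; apply: cvgr_dist_lt => //; apply: Hl => //; exact: KX.
apply: (le_lt_trans (Hom _ _ _ J'k (Kz s) _)); first by near: k; exact: Ky.
apply: omd; rewrite normr_ge0/=.
by near: k; apply: cvgr_dist_lt => //; exact: yz.
Unshelve. all: by end_near.
Qed.

(** The strips on which the floor is constant are countably many Borel sets, and on each the
    function coincides with some [b z]. *)
Lemma measurable_fun_floor_piecewise (b : int -> R -> R) (c : R) :
  (forall z, measurable_fun setT (b z)) ->
  measurable_fun setT (fun s => b (Num.floor (c * s)) s).
Proof.
move=> mb _ B mB; rewrite setTI.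
rewrite (_ : _ @^-1` _ =
    \bigcup_z ([set s | z%:~R <= c * s < (z + 1)%:~R] `&` (b z) @^-1` B)); last first.
  apply/seteqP; split => s /=.
    by move=> Bs; exists (Num.floor (c * s)) => //; split => //=; exact: floor_itv.
  by move=> [z _ [/= /floor_def ->]].
apply: countable_bigcupT_measurable => [|z]; first exact: countableP.
apply: measurableI; last first.
  by have := mb z measurableT B mB; rewrite setTI.
have mc : measurable_fun setT (fun s : R => c * s).
  by apply: continuous_measurable_fun => s; apply: cvgM; [exact: cvg_cst|exact: cvg_id].
have := mc measurableT `[z%:~R, (z + 1)%:~R[%classic (measurable_itv _).
by rewrite setTI; congr measurable; apply/seteqP; split => s /=; rewrite in_itv.
Qed.

Lemma cvg_floor_sampling (V : topologicalType) (x : R -> V) (s : R) : continuous x ->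
  x ((Num.floor (k.+1%:R * s))%:~R / k.+1%:R) @[k --> \oo] --> x s.
Proof.
move=> cx; apply: (cvg_comp (fun k => (Num.floor (k.+1%:R * s))%:~R / k.+1%:R : R) x _ (cx s)).
apply/cvgrPdist_le => e e0; near=> k.
have k0 : 0 < k.+1%:R :> R by [].
have /andP[h1 h2] := floor_itv (k.+1%:R * s).
have -> : s - (Num.floor (k.+1%:R * s))%:~R / k.+1%:R =
    (k.+1%:R * s - (Num.floor (k.+1%:R * s))%:~R) / k.+1%:R.
  by rewrite mulrBl mulrAC divff ?mul1r// gt_eqF.
rewrite ger0_norm; last by rewrite divr_ge0 ?subr_ge0.
apply: (@le_trans _ _ k.+1%:R^-1).
  rewrite -[leRHS]mul1r ler_wpM2r ?invr_ge0 ?ltW//.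
  by move: h2; rewrite intrD; lra.
apply: ltW; near: k; exact: (near_infty_natSinv_lt (PosNum e0)).
Unshelve. all: by end_near.
Qed.

(* Sampling x at the points of (k + 1)^-1 Z makes g (gam k + s) (x s) piecewise of
   the form g (gam k + s) xi with xi fixed; the uniform modulus of continuity
   removes the sampling error in the limit. *)
Lemma limiting_function_Borel (n m : nat) (X K : set 'cV[R]_n)
    (g : R -> 'cV[R]_n -> 'cV[R]_m) (gam : nat -> R) gl (x : R -> 'cV[R]_n) (j : 'I_m) :
  times_to_infty gam -> measurable_in_time nonneg_times X g ->
  continuous_in_state_uniformly nonneg_times X g ->
  uniformly_bounded nonneg_times X g ->
  limiting_function X g gam gl -> compact K -> K `<=` X ->
  continuous x -> (forall s, K (x s)) ->
  exists2 M : R, 0 <= M & exists phi : R -> R,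
    [/\ measurable_fun setT phi, forall s, `|phi s| <= M &
        {ae mu, forall s, gl s (x s) j ord0 = phi s}].
Proof.
move=> gamy mg cg [J' J'c Hb] lg cK KX cx Kx.
have [M0 HM0] := Hb K cK KX; pose M := Num.max 0 M0.
have M_ge0 : 0 <= M by rewrite le_max lexx.
exists M => //.
pose q (k : nat) (z : int) : R := z%:~R / k.+1%:R.
(* At a fixed sampling point the map is Lebesgue measurable in time, hence has a Borel version. *)
have /choice[b Hb'] : forall kz : nat * int, exists b : R -> R, measurable_fun setT b /\
    {ae mu, forall t, nonneg_times t -> g t (x (q kz.1 kz.2)) j ord0 = b t}.
  move=> [k z]; have [b mb Eb] := lebesgue_measurable_ae_Borel (measurable_itv _)
    (mg (x (q k z)) (KX _ (Kx _)) j).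
  by exists b.
pose y (k : nat) (s : R) := x (q k (Num.floor (k.+1%:R * s))).
(* A Borel version obeys the bound only almost everywhere; truncation enforces it at every time
   without changing the limit. *)
pose G k s := Num.max (- M) (Num.min M
  (b (k, Num.floor (k.+1%:R * s)) (gam k + s))).
have mG k : measurable_fun setT (G k).
  apply: measurable_maxr; first exact: measurable_cst.
  apply: measurable_minr; first exact: measurable_cst.
  apply: (measurable_fun_floor_piecewise (b := fun z s => b (k, z) (gam k + s))) => z.
  apply: measurableT_comp; first by have [] := Hb' (k, z).
  by apply: continuous_measurable_fun => s; apply: cvgD; [exact: cvg_cst|exact: cvg_id].
have GM k s : `|G k s| <= M.
  by rewrite ler_norml le_max lexx /= ge_max ge_min lexx /= andbT; lra.
(* There are countably many pairs of a shift and a sampling point, so a single null set suffices. *)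
have aeb : {ae mu, forall s, forall kz : nat * int, 0 <= gam kz.1 + s ->
    g (gam kz.1 + s) (x (q kz.1 kz.2)) j ord0 = b kz (gam kz.1 + s)}.
  apply: ae_countable => kz.
  have [_] := Hb' kz => /(@ae_translation (gam kz.1) _); apply: ae_imp => s + h0; apply.
  by rewrite /nonneg_times/= in_itv/= h0.
have yx s : y k s @[k --> \oo] --> x s by exact: cvg_floor_sampling.
have Ky s : \forall k \near \oo, K (y k s) by apply: nearW => k; exact: Kx.
have aeg := limiting_function_along gamy cg lg cK KX Kx Ky yx.
suff aeG : {ae mu, forall t, [set: R] t ->
    G k t @[k --> \oo] --> gl t (x t) j ord0}.
  have [phi [mphi phiM Ephi]] := ae_cvg_Borel M_ge0 mG GM aeG.
  by exists phi; split => //; apply: ae_imp Ephi => s /(_ I).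
apply: ae_imp (ae_and (ae_and aeb aeg) (ae_conegligible gam J'c)) => t [[H1 H2] H3] _.
have : g (gam k + t) (y k t) j ord0 @[k --> \oo] --> gl t (x t) j ord0.
  exact: cvg_coord.
apply: cvg_trans; apply: near_eq_cvg; near=> k.
have h0 : 0 <= gam k + t by near: k; exact: times_to_infty_near.
rewrite /G -(H1 (k, _))//=.
have : `|g (gam k + t) (y k t) j ord0| <= M.
  rewrite (le_trans (norm_coord_le _ _))// (le_trans (HM0 _ _ (H3 _ h0) (Kx _)))//.
  by rewrite le_max lexx orbT.
by rewrite ler_norml => /andP[? ?]; rewrite min_r// max_r.
Unshelve. all: by end_near.
Qed.

End limiting_functions.

(** * Weak limits of switching signals *)

Section weak_limits.
Context {R : realType}.
Notation mu := (@lebesgue_measure R).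

(** Away from its jumps a signal is locally constant, so a level set is open up to a subset of the
    jump set, which is countable. *)
Lemma switching_signal_measurable (N : nat) (sigma : R -> 'I_N) (i : 'I_N) :
  switching_signal sigma -> measurable [set t | sigma t = i].
Proof.
move=> [finj _].
have cj : countable (jump sigma).
  rewrite (_ : jump sigma = \bigcup_k (`[- k%:R, k%:R]%classic `&` jump sigma)).
    apply: bigcup_countable; first exact: countableP.
    by move=> k _; apply: finite_set_countable; exact: finj.
  apply/seteqP; split=> t; last by move=> [k _ []].
  move=> jt; exists (Num.bound `|t|) => //; split => //=.
  have /ltW : `|t| < (Num.bound `|t|)%:R by exact: archi_boundP.
  by rewrite in_itv/= ler_norml.
rewrite (_ : [set t | sigma t = i] =
   interior [set t | sigma t = i] `|` ([set t | sigma t = i] `&` jump sigma)); last first.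
  apply/seteqP; split=> t; last by case=> [/interior_subset//|[]].
  move=> st; have [jt|njt] := pselect (jump sigma t); first by right.
  left; move: njt => /contrapT; apply: filterS => s /= ->; exact: st.
apply: measurableU; first exact: open_measurable (open_interior _).
apply: countable_measurable; first exact: measurable_set1.
by apply: sub_countable cj; apply: subset_card_le; exact: subIsetr.
Qed.

Lemma switching_signal_indicator_measurable (N : nat) (sigma : R -> 'I_N) (i : 'I_N) (a : R) :
  switching_signal sigma -> measurable_fun setT (fun t => (sigma (a + t) == i)%:R : R).
Proof.
move=> sw.
have /(@measurable_indic _ _ R setT) mi := switching_signal_measurable i sw.
have -> : (fun t => (sigma (a + t) == i)%:R : R) =
    (\1_[set t | sigma t = i] : R -> R) \o (fun t => a + t).
  apply/funext => t /=; rewrite indicE; congr (nat_of_bool _)%:R.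
  by apply/eqP/idP => [E|/set_mem//]; exact/mem_set.
apply: measurableT_comp => //.
by apply: continuous_measurable_fun => s; apply: cvgD; [exact: cvg_cst|exact: cvg_id].
Qed.


(** Testing against [phi], cut off outside [[a, b]], times the [i]-th canonical vector isolates mode
    [i]. The Borel function [v] stands in for a control coordinate that is only Lebesgue
    measurable. *)
Lemma weak_limit_coord (N : nat) (gam : nat -> R) (sigma_ : nat -> R -> 'I_N)
    (u : R -> 'cV[R]_N) (i : 'I_N) :
  (forall k, switching_signal (sigma_ k)) -> controls u ->
  weakly_converges (fun k t => control_of (sigma_ k) (gam k + t)) u ->
  exists v : R -> R, [/\ measurable_fun setT v, (forall t, 0 <= v t <= 1),
    {ae mu, forall t, u t i ord0 = v t} &
    forall (phi : R -> R) (M a b : R), measurable_fun setT phi ->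
      (forall t, `|phi t| <= M) ->
      \int[mu]_(t in `[a, b]) (phi t * (sigma_ k (gam k + t) == i)%:R) @[k --> \oo]
        --> \int[mu]_(t in `[a, b]) (phi t * v t)].
Proof.
move=> sw [mu_ su] wc.
have [v0 mv0 Ev0] := lebesgue_measurable_ae_Borel measurableT (mu_ i).
(* The Borel version may leave [[0, 1]] on a null set; truncation repairs this and keeps equality
   almost everywhere. *)
pose v t := Num.max 0 (Num.min 1 (v0 t)).
have u01 t : 0 <= u t i ord0 <= 1.
  have [u0 u1] := su t; rewrite u0/= -u1 (bigD1 i)//= lerDl.
  exact: sumr_ge0.
have mv : measurable_fun setT v.
  apply: measurable_maxr; first exact: measurable_cst.
  by apply: measurable_minr => //; exact: measurable_cst.
have v01 t : 0 <= v t <= 1.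
  by rewrite le_max lexx/= ge_max ler01 ge_min lexx.
have uv : {ae mu, forall t, u t i ord0 = v t}.
  apply: ae_imp Ev0 => t /(_ I) E; have /andP[h1 h2] := u01 t.
  by rewrite /v -E min_r// max_r.
exists v; split => // phi M a b mphi phiM.
pose psi := phi \_ `[a, b].
have mpsi : measurable_fun setT psi.
  by apply: (measurable_restrictT _ (measurable_itv _)).1; exact: measurable_funTS.
have ipsi (w : R -> R) : measurable_fun setT w -> (forall t, `|w t| <= 1) ->
    mu.-integrable setT (EFin \o (psi \* w)).
  move=> mw w1.
  have : mu.-integrable `[a, b] (EFin \o (phi \* w)).
    apply: (@bounded_measurable_integrable _ _ _ M); first exact: measurable_funM.
    move=> t; rewrite normrM -[M]mulr1 ler_pM//.
  rewrite integrable_mkcond//.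
  apply: eq_integrable => // t _; rewrite patchE /psi /= patchE.
  by case: ifP => //; rewrite mul0r.
have psiE (w : R -> R) : \int[mu]_t (psi t * w t) = \int[mu]_(t in `[a, b]) (phi t * w t).
  rewrite [RHS]Rintegral_mkcond; apply: eq_Rintegral => t _.
  by rewrite /psi !patchE; case: ifP => //; rewrite mul0r.
have mpsi_ (w : R -> R) : measurable_fun setT w -> measurable_fun setT (fun t => psi t * w t).
  by move=> mw; exact: measurable_funM.
pose e : 'cV[R]_N := delta_mx i ord0.
have dotE t (w : 'cV[R]_N) : ((psi t *: e)^T *m w) ord0 ord0 = psi t * w i ord0.
  rewrite mxE (bigD1 i)//= big1 ?addr0; last first.
    by move=> j ji; rewrite !mxE (negbTE ji)/= mulr0 mul0r.
  by rewrite !mxE !eqxx mulr1.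
have Ek k : \int[leb]_t ((psi t *: e)^T *m control_of (sigma_ k) (gam k + t)) ord0 ord0 =
   \int[mu]_(t in `[a, b]) (phi t * (sigma_ k (gam k + t) == i)%:R).
  rewrite -psiE.
  have mc := switching_signal_indicator_measurable i (gam k) (sw k).
  rewrite -(Rintegral_leb (mpsi_ _ mc) (ipsi _ mc _)).2; last first.
    by move=> t; rewrite ger0_norm; case: eqP.
  apply: eq_Rintegral => t _; rewrite dotE /control_of /canonical_vector mxE andbT.
  by rewrite eq_sym.
have Ev : \int[leb]_t ((psi t *: e)^T *m u t) ord0 ord0 = \int[mu]_(t in `[a, b]) (phi t * v t).
  rewrite -psiE.
  have v1 t : `|v t| <= 1 by have /andP[h1 h2] := v01 t; rewrite ger0_norm.
  rewrite -(Rintegral_leb (mpsi_ _ mv) (ipsi _ mv v1)).2.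
  transitivity (\int[leb]_t (psi t * u t i ord0)).
    by apply: eq_Rintegral => t _; exact: dotE.
  rewrite /Rintegral; congr fine.
  have mpsi' : @measurable_fun _ _ (lebesgueTypeR R) (measurableTypeR R) setT psi.
    by move=> _ B mB; apply: sub_caratheodory; exact: mpsi.
  have mv' : @measurable_fun _ _ (lebesgueTypeR R) (measurableTypeR R) setT v.
    by move=> _ B mB; apply: sub_caratheodory; exact: mv.
  apply: ae_eq_integral; first exact: measurableT.
  - by apply/measurable_EFinP; exact: (measurable_funM mpsi' (mu_ i)).
  - by apply/measurable_EFinP; exact: (measurable_funM mpsi' mv').
  - by apply/ae_lebE; apply: ae_imp uv => t -> _.
rewrite -Ev -(funext Ek); apply: wc => j.
have [->|ji] := eqVneq j i; last first.
  rewrite (_ : (fun t => _) = cst 0%E); first exact: integrable0.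
  by apply/funext => t; rewrite !mxE (negbTE ji)/= mulr0.
rewrite (_ : (fun t => _) = EFin \o psi); last first.
  by apply/funext => t; rewrite !mxE !eqxx/= mulr1.
apply: (Rintegral_leb mpsi _).1.
have : mu.-integrable setT (EFin \o (psi \* cst 1)).
  by apply: ipsi => // t; rewrite normr1.
by apply: eq_integrable => // t _; rewrite /= mulr1.
Qed.

(** Bounded convergence sends the integrals of [eta * c k] to 0, weak convergence sends them to that
    of [eta * v]. A nonnegative function with zero integral over every window vanishes almost
    everywhere. *)
Lemma weak_limit_vanishing (M : R) (eta v : R -> R) (c : nat -> R -> R) :
  measurable_fun setT eta -> measurable_fun setT v -> (forall t, 0 <= v t <= 1) ->
  (forall k, measurable_fun setT (c k)) -> (forall k t, 0 <= c k t <= 1) ->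
  (forall t, 0 <= eta t <= M) ->
  (forall a b, \int[mu]_(t in `[a, b]) (eta t * c k t) @[k --> \oo]
    --> \int[mu]_(t in `[a, b]) (eta t * v t)) ->
  {ae mu, forall t, eta t * c k t @[k --> \oo] --> 0} ->
  {ae mu, forall t, eta t * v t = 0}.
Proof.
move=> meta mv v01 mc c01 etaM wc ec0.
have M0 : 0 <= M by have /andP[] := etaM 0; exact: le_trans.
have bnd x y : 0 <= x <= M -> 0 <= y <= 1 -> `|x * y| <= M.
  move=> /andP[x0 xM] /andP[y0 y1]; rewrite ger0_norm ?mulr_ge0//.
  by rewrite -[M]mulr1 ler_pM.
have H (S : nat) : {ae mu, forall t, `[- S%:R, S%:R]%classic t -> eta t * v t = 0}.
  have I0 : \int[mu]_(t in `[- S%:R, S%:R]) (eta t * v t) = 0.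
    have h := wc (- S%:R) S%:R.
    have h0 : \int[mu]_(t in `[- S%:R, S%:R]) (eta t * c k t) @[k --> \oo] -->
        \int[mu]_(t in `[- S%:R, S%:R]) (cst 0 t : R).
      apply: (@Rintegral_bounded_cvg _ _ _ M).
      - by move=> k; exact: measurable_funM.
      - exact: measurable_cst.
      - by move=> k t; exact: bnd.
      - by apply: ae_imp ec0 => t ? _.
    rewrite (cvg_unique _ h h0)//.
    by rewrite /Rintegral integral0_eq.
  have mev : measurable_fun setT (fun t => eta t * v t) by exact: measurable_funM.
  have iev := @bounded_measurable_integrable R (- S%:R) S%:R M _ mev
    (fun t => bnd _ _ (etaM t) (v01 t)).
  have I1 : (\int[mu]_(t in `[(- S%:R)%R, S%:R%R]) `|(eta t * v t)%:E| = 0)%E.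
    transitivity (\int[mu]_(t in `[(- S%:R)%R, S%:R%R]) (eta t * v t)%:E)%E.
      apply: eq_integral => t _; rewrite gee0_abs// lee_fin.
      by apply: mulr_ge0; [have /andP[] := etaM t|have /andP[] := v01 t].
    have fv : (\int[mu]_(t in `[(- S%:R)%R, S%:R%R]) (eta t * v t)%:E)%E \is a fin_num.
      exact: integrable_fin_num iev.
    by rewrite -[LHS](fineK fv); move: I0; rewrite /Rintegral => ->.
  apply: ae_imp ((ae_eq_integral_abs mu _ _).1 I1) => [t H /H []//||].
    exact: measurable_itv.
  by apply/measurable_EFinP; apply: measurable_funTS; exact: mev.
apply: ae_imp (ae_countable H) => t Ht.
apply: (Ht (Num.bound `|t|)).
have /ltW : `|t| < (Num.bound `|t|)%:R by exact: archi_boundP.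
by rewrite /= in_itv/= ler_norml.
Qed.

End weak_limits.

(** * Convex combinations and the control sets *)

Section convex_combinations.
Context {R : realType} {N : nat}.

(** Dividing by the total weight lets the induction run over the list, whose tails have weights that
    do not sum to 1. Points of weight zero are skipped, so only the others must lie in [C]. *)
Lemma convex_set_combination (V : lmodType R) (C : set (convex_lmodType V)) (I : eqType) (s : seq I)
    (w : I -> R) (e : I -> V) :
  convex_set C -> (forall i, 0 <= w i) -> (forall i, w i != 0 -> C (e i)) ->
  \sum_(i <- s) w i != 0 ->
  C ((\sum_(i <- s) w i)^-1 *: \sum_(i <- s) w i *: e i).
Proof.
move=> cC w0 we; elim: s => [|i s IH]; first by rewrite big_nil eqxx.
rewrite !big_cons; set W := \sum_(j <- s) w j; set E := \sum_(j <- s) w j *: e j.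
have W0 : 0 <= W by exact: sumr_ge0.
have [wi0|wi] := eqVneq (w i) 0; first by rewrite wi0 scale0r !add0r => /IH.
have wi_gt0 : 0 < w i by rewrite lt_neqAle eq_sym wi w0.
have [W00 _|Wn0 _] := eqVneq W 0.
  have -> : E = 0.
    rewrite /E big1_seq// => j /= js.
    have := W00; rewrite /W => /eqP; rewrite psumr_eq0//.
    by move=> /allP/(_ _ js)/eqP ->; rewrite scale0r.
  by rewrite W00 !addr0 scalerA mulVf// scale1r; exact: we.
have Wgt0 : 0 < W by rewrite lt_neqAle eq_sym Wn0 W0.
have l0 : 0 <= w i / (w i + W) by rewrite divr_ge0// addr_ge0.
have l1 : w i / (w i + W) <= 1 by rewrite ler_pdivrMr ?mul1r ?lerDl// addr_gt0.
(* The new average is the convex combination of [e i] and the average of the tail, with coefficient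
   [w i / (w i + W)] on [e i]. *)
have := cC (e i) (W^-1 *: E) (Itv01 l0 l1); rewrite !inE => /(_ (we _ wi) (IH Wn0)).
congr C; rewrite /conv/= scalerDr !scalerA; congr (_ *: _ + _ *: _).
  by rewrite mulrC.
rewrite /unstable.onem; field; apply/andP; split => //.
by rewrite gt_eqF// addr_gt0.
Qed.

Lemma simplex_control_set_at (n : nat) (chi : 'I_N -> set 'cV[R]_n) (xi : 'cV[R]_n)
    (w : 'cV[R]_N) :
  simplex w -> (forall i, w i ord0 != 0 -> chi i xi) -> control_set_at chi xi w.
Proof.
move=> [w0 w1] wchi C [cC AC].
have := @convex_set_combination _ C _ (index_enum 'I_N) (fun i => w i ord0) canonical_vector cC w0.
rewrite w1 invr1 scale1r oner_eq0.
have -> : \sum_i w i ord0 *: canonical_vector i = w :> 'cV[R]_N.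
  apply/colP => j; rewrite summxE (bigD1 j)//= big1 ?addr0.
    by rewrite !mxE !eqxx mulr1.
  by move=> i ij; rewrite !mxE eq_sym (negbTE ij) mulr0.
by apply=> // i wi; apply: AC; exists i => //=; exact: wchi.
Qed.

End convex_combinations.

(** * Extraction of subsequences *)

Section subsequences.

Lemma homo_ltn_geq (phi : nat -> nat) : {homo phi : i j / (i < j)%N} ->
  forall k, (k <= phi k)%N.
Proof. by move=> h; elim=> // k IH; exact: leq_ltn_trans IH (h _ _ (ltnSn k)). Qed.

Lemma cvg_infty_geq (phi : nat -> nat) : (forall k, (k <= phi k)%N) -> phi @ \oo --> \oo.
Proof.
move=> h P [m _ Hm]; exists m => // k /= mk.
by apply: Hm; exact: leq_trans (h k).
Qed.

(** Extraction proceeds one index at a time: heredity of [P] allows the next extraction, and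
    heredity of [A] preserves what the earlier ones achieved. *)
Lemma common_subsequence (T I : Type) (P : set (nat -> T)) (A : I -> set (nat -> T)) (s : seq I) :
  (forall t phi, {homo phi : i j / (i < j)%N} -> P t -> P (t \o phi)) ->
  (forall i t phi, {homo phi : i j / (i < j)%N} -> A i t -> A i (t \o phi)) ->
  (forall i t, P t -> exists2 phi : nat -> nat, {homo phi : i j / (i < j)%N} & A i (t \o phi)) ->
  forall t, P t -> exists2 phi : nat -> nat, {homo phi : i j / (i < j)%N} &
    foldr (fun i Q => A i (t \o phi) /\ Q) True s.
Proof.
move=> Psub Asub ex t Pt; elim: s => [|i s [phi hphi IH]]; first by exists id.
have [psi hpsi Ai] := ex i (t \o phi) (Psub _ _ hphi Pt).
exists (phi \o psi); first by move=> a b /hpsi/hphi.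
split => //; elim: s IH => //= j s IHs [Aj As]; split; last exact: IHs.
exact: (Asub _ _ _ hpsi Aj).
Qed.

Context {R : realType}.

Lemma times_to_infty_subseq (t : nat -> R) (phi : nat -> nat) :
  {homo phi : i j / (i < j)%N} -> times_to_infty t -> times_to_infty (t \o phi).
Proof.
move=> hphi [t0 ty]; split; first by move=> k; exact: t0.
by apply: (cvg_comp phi t _ ty); exact/cvg_infty_geq/homo_ltn_geq.
Qed.

Lemma admissible_subseq (n m : nat) (X : set 'cV[R]_n) (g : R -> 'cV[R]_n -> 'cV[R]_m)
    (t : nat -> R) (phi : nat -> nat) :
  {homo phi : i j / (i < j)%N} -> admissible X g t -> admissible X g (t \o phi).
Proof.
move=> hphi [ty [gl [E nE Hl]]]; split; first exact: times_to_infty_subseq.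
exists gl; exists E => // xi s Xxi Es.
apply: (cvg_comp phi (fun k => g (t k + s) xi) _ (Hl xi s Xxi Es)).
exact/cvg_infty_geq/homo_ltn_geq.
Qed.

Lemma common_admissible_subseq (n p N : nat) (X : set 'cV[R]_n)
    (fhat : R -> 'cV[R]_n -> 'I_N -> 'cV[R]_n) (h : R -> 'cV[R]_n -> 'I_N -> 'cV[R]_p)
    (t : nat -> R) :
  (forall i, precompact_in_time X (fun t xi => fhat t xi i)) ->
  (forall i, precompact_in_time X (fun t xi => h t xi i)) ->
  times_to_infty t ->
  exists2 phi : nat -> nat, {homo phi : i j / (i < j)%N} & common_admissible X fhat h (t \o phi).
Proof.
move=> pf ph ty.
pose A (i : 'I_N) : set (nat -> R) :=
  admissible X (fun t xi => fhat t xi i) `&` admissible X (fun t xi => h t xi i).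
have [] := @common_subsequence R 'I_N times_to_infty A (enum 'I_N) _ _ _ t ty.
- by move=> s phi; exact: times_to_infty_subseq.
- by move=> i s phi hphi [a1 a2]; split; exact: admissible_subseq.
- move=> i s sy; have [phi1 h1 a1] := pf i s sy.
  have [phi2 h2 a2] := ph i (s \o phi1) (times_to_infty_subseq h1 sy).
  exists (phi1 \o phi2); first by move=> a b /h2/h1.
  by split => //; exact: (admissible_subseq h2 a1).
- move=> phi hphi Hall; exists phi => // i _.
  have : i \in enum 'I_N by rewrite mem_enum.
  elim: (enum 'I_N) Hall => //= j s IH [Aj As].
  by rewrite inE => /orP[/eqP ->|/IH]; [exact: Aj|apply].
Qed.

End subsequences.

(** * Zeroing pairs along a changing mode *)

Section zeroing.
Context {R : realType}.

(** A zeroing pair concerns one mode, while [i_ k] varies with [k]. If convergence failed, one of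
    the finitely many modes would be active infinitely often with [g] bounded away from 0, against
    the zeroing property along those times. *)
Lemma zeroing_pair_switched (n p N : nat) (X K : set 'cV[R]_n)
    (h : R -> 'cV[R]_n -> 'I_N -> 'cV[R]_p) (g : R -> 'cV[R]_n -> 'I_N -> 'cV[R]_n)
    (eps : R) (tau : nat -> R) (v : nat -> 'cV[R]_n) (i_ : nat -> 'I_N) :
  (forall i, zeroing_pair X (fun t xi => h t xi i) (fun t xi => g t xi i)) ->
  compact K -> K `<=` X -> 0 < eps ->
  tau @ \oo --> +oo ->
  (\forall k \near \oo, [/\ 0 <= tau k, K (v k) & eps <= `|v k|]) ->
  h (tau k) (v k) (i_ k) @[k --> \oo] --> (0 : 'cV[R]_p) ->
  g (tau k) (v k) (i_ k) @[k --> \oo] --> (0 : 'cV[R]_n).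
Proof.
move=> zp cK KX eps0 tauy good h0; apply/cvgrPdist_lt => e e0; apply: contrapT => bad.
pose B i k := [/\ 0 <= tau k, K (v k), eps <= `|v k|, i_ k = i & e <= `|g (tau k) (v k) i|].
have [i Bi] : exists i, forall m, exists2 k, (m <= k)%N & B i k.
  apply: contrapT => nB; apply: bad.
  have {}nB i : \forall k \near \oo, ~ B i k.
    apply: contrapT => H; apply: nB; exists i => m.
    apply: contrapT => nk; apply: H; exists m => // k /= mk Bk.
    by apply: nk; exists k.
  have {}nB : \forall k \near \oo, forall i, ~ B i k by apply: filter_forall.
  apply: filterS2 good nB => k [t0 Kv ev] nBk.
  rewrite sub0r normrN ltNge; apply/negP => ge.
  by apply: (nBk (i_ k)).
(* The bound [m <= psi m] makes [psi] tend to infinity even if selected indices repeat. *)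
have /choice[psi Hpsi] : forall m, exists k, (m <= k)%N /\ B i k.
  by move=> m; have [k mk Bk] := Bi m; exists k.
have psioo : psi @ \oo --> \oo by apply: cvg_infty_geq => m; have [] := Hpsi m.
have tpsi : times_to_infty (tau \o psi).
  split; first by move=> m /=; have [_ []] := Hpsi m.
  exact: (cvg_comp psi tau psioo tauy).
have Kpsi m : K (v (psi m)) /\ eps <= `|v (psi m)| by have [_ []] := Hpsi m.
have := zp i (tau \o psi) K eps (v \o psi) tpsi cK KX eps0 Kpsi _.
have hpsi : h (tau (psi m)) (v (psi m)) i @[m --> \oo] --> (0 : 'cV[R]_p).
  have := cvg_comp psi (fun k => h (tau k) (v k) (i_ k)) psioo h0.
  apply: cvg_trans; apply: near_eq_cvg; apply: nearW => m /=.
  by have [_ [_ _ _ ->]] := Hpsi m.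
move=> /(_ hpsi) /cvgrPdist_lt /(_ _ e0) [m _ /(_ m (leqnn m))] /=.
by rewrite sub0r normrN ltNge; have [_ [_ _ _ _ ->]] := Hpsi m.
Qed.

End zeroing.

(** * Lipschitz bounds for solutions and differentiation of integrals *)

Section switched_solutions.
Context {R : realType} {n N : nat}.
Notation mu := (@lebesgue_measure R).
Implicit Types (X K : set 'cV[R]_n) (f : R -> 'cV[R]_n -> 'I_N -> 'cV[R]_n).

Lemma uniformly_bounded_family (m : nat) X K (g : R -> 'cV[R]_n -> 'I_N -> 'cV[R]_m) :
  (forall i, uniformly_bounded nonneg_times X (fun t xi => g t xi i)) ->
  compact K -> K `<=` X ->
  exists2 M : R, 0 <= M &
    {ae mu, forall t, 0 <= t -> forall i xi, K xi -> `|g t xi i| <= M}.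
Proof.
move=> ug cK KX.
have /choice[M HM] : forall i, exists M : R,
    {ae mu, forall t, 0 <= t -> forall xi, K xi -> `|g t xi i| <= M}.
  move=> i; have [J' J'c /(_ K cK KX)[M HM]] := ug i; exists M.
  have := ae_conegligible (fun=> 0) J'c.
  apply: ae_imp => t H t0 xi Kxi; apply: HM => //.
  by rewrite -[t]add0r; apply: (H 0%N); rewrite add0r.
(* The sum serves as a maximum of the bounds over all modes. *)
exists (\sum_i `|M i|); first exact: sumr_ge0.
apply: ae_imp (ae_countable HM) => t H t0 i xi Kxi.
rewrite (le_trans (H i t0 xi Kxi))// (le_trans (ler_norm _))//.
by rewrite (bigD1 i)//= lerDl sumr_ge0.
Qed.

(** While the state stays in [K] the velocity is bounded by [M] almost everywhere, and absolute
    continuity turns this into a bound on increments. *)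
Lemma solution_lipschitz X K f (sigma : R -> 'I_N) (x : curve R n) (M c d : R) :
  solution X f sigma x -> 0 <= M ->
  {ae mu, forall t, 0 <= t -> forall i xi, K xi -> `|f t xi i| <= M} ->
  c <= d -> (forall t, c <= t <= d -> curve_dom x t /\ K (x t)) ->
  `|x d - x c| <= M * (d - c).
Proof.
move=> [t00 _ _ acx /ae_lebE dx] M0 fM cd Hcd.
apply: (@absolutely_continuous_lipschitz _ _ x (fun t => f t (x t) (sigma t))) => //.
  by apply: acx => t /=; rewrite in_itv/= => /Hcd[].
apply: ae_imp (ae_and dx fM) => t [H1 H2] /andP[/ltW ct /ltW td].
have [|dt Kt] := Hcd t; first by rewrite ct td.
split; first exact: H1.
by apply: H2 => //; have [h1 _] := dt; exact: le_trans h1.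
Qed.

Lemma lipschitz_absolutely_continuous (m : nat) (x : R -> 'cV[R]_m) (M a b : R) :
  0 <= M -> (forall c d, `|x d - x c| <= M * `|d - c|) ->
  absolutely_continuous a b x.
Proof.
move=> M0 lx e e0; exists (e / (M + 1)); first by rewrite divr_gt0//; lra.
move=> q l r lr _; rewrite ltr_pdivlMr; last lra.
move=> H; apply: (@le_lt_trans _ _ (\sum_j (r j - l j) * M)).
  apply: ler_sum => j _; have [_ [lrj _]] := lr j.
  by rewrite mulrC (le_trans (lx _ _))// ger0_norm ?subr_ge0.
rewrite -mulr_suml.
have : 0 <= \sum_j (r j - l j).
  by apply: sumr_ge0 => j _; have [_ [lrj _]] := lr j; rewrite subr_ge0.
nra.
Qed.

Lemma lipschitz_continuous (m : nat) (x : R -> 'cV[R]_m) (M : R) :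
  0 <= M -> (forall c d, `|x d - x c| <= M * `|d - c|) -> continuous x.
Proof.
move=> M0 lx t; apply/cvgrPdist_lt => e e0; near=> s.
apply: (le_lt_trans (lx _ _)).
have : `|t - s| < e / (M + 1).
  near: s; apply: cvgr_dist_lt; first exact: cvg_id.
  by rewrite divr_gt0//; lra.
rewrite ltr_pdivlMr; last lra.
have := normr_ge0 (t - s); nra.
Unshelve. all: by end_near.
Qed.

Lemma Rintegral_sum_bounded (I : finType) (a b M : R) (g : I -> R -> R) :
  (forall i, measurable_fun setT (g i)) -> (forall i t, `|g i t| <= M) ->
  \int[mu]_(t in `[a, b]) (\sum_i g i t) = \sum_i \int[mu]_(t in `[a, b]) g i t.
Proof.
move=> mg gM; rewrite /Rintegral.
under eq_integral do rewrite -sumEFin.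
have ig i : mu.-integrable `[a, b] (EFin \o g i).
  exact: bounded_measurable_integrable (mg i) (gM i).
rewrite integral_sum//.
rewrite (eq_bigr (fun i => (fine (\int[mu]_(t in `[a, b]) (g i t)%:E)%E)%:E)).
  by rewrite sumEFin.
move=> i _; rewrite fineK//.
exact: integrable_fin_num (ig i).
Qed.

(** Lebesgue differentiation of the integral started at [- S%:R] settles the times after it, where
    [x] differs from that integral by a constant; countably many [S] cover the line. *)
Lemma integral_derivative (x F : R -> R) (M : R) :
  measurable_fun setT F -> (forall t, `|F t| <= M) ->
  (forall a b, a < b -> x b - x a = \int[mu]_(t in `[a, b]) F t) ->
  {ae mu, forall t, is_derive t (1 : R) x (F t)}.
Proof.
move=> mF FM xF.
have locF : locally_integrable [set: R] F.
  split => //; first exact: openT.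
  move=> C _ cC.
  have mC : measurable C by exact: compact_measurable.
  have : mu.-integrable C (EFin \o F).
    apply: measurable_bounded_integrable => //.
    - exact: compact_finite_measure.
    - exact: measurable_funTS.
    - exists M; split; first exact: num_real.
      by move=> z Mz t _; rewrite /= (le_trans (FM t))// ltW.
  by move=> /integrableP[_].
have H (S : nat) : {ae mu, forall t : R, - S%:R < t -> is_derive t (1 : R) x (F t)}.
  pose G z := \int[mu]_(t in `[- S%:R, z]) F t.
  have := @FTC1 R F (BLeft (- S%:R)) (fun z => bounded_measurable_integrable _ _ mF FM) locF.
  rewrite -/G; apply: ae_imp => t H St; have [|dG GE] := H; first by rewrite lte_fin.
  have dG' : is_derive t (1 : R) G (F t) by apply: DeriveDef; [exact: dG|rewrite -GE derive1E].
  have : is_derive t (1 : R) (G + cst (x (- S%:R))) (F t + 0) by exact: is_deriveD.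
  rewrite addr0; apply: near_eq_is_derive.
  near=> s; rewrite /G /=.
  have sS : - S%:R < s by near: s; exact: lt_nbhsr.
  by rewrite [LHS]/= fctE -(xF _ _ sS) subrK.
apply: ae_imp (ae_countable H) => t Ht; apply: (Ht (Num.bound `|t|)).
have : `|t| < (Num.bound `|t|)%:R by exact: archi_boundP.
by rewrite ltr_norml => /andP[].
Unshelve. all: by end_near.
Qed.

End switched_solutions.

Lemma cvg_norm_sub0 (R : realType) (V : normedModType R) (u : nat -> V) (l : V) :
  u k @[k --> \oo] --> l -> `|u k - l| @[k --> \oo] --> (0 : R).
Proof.
move=> ul; rewrite [X in _ --> X](_ : _ = `|l - l|); last by rewrite subrr normr0.
exact: cvg_norm (cvgB ul (cvg_cst l)).
Qed.

Lemma cvg_norm0 (R : realType) (V : normedModType R) (u : nat -> V) :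
  u k @[k --> \oo] --> (0 : V) -> `|u k| @[k --> \oo] --> (0 : R).
Proof. by move=> u0; rewrite -[X in _ --> X](@normr0 _ V); exact: cvg_norm. Qed.

(** * Limits of shifted trajectories *)

Section limiting_trajectories.
Context {R : realType} {n p N : nat}.
Notation mu := (@lebesgue_measure R).
Context (X K : set 'cV[R]_n) (f : R -> 'cV[R]_n -> 'I_N -> 'cV[R]_n).
Context (gam : nat -> R) (x_ : nat -> curve R n) (sigma_ : nat -> R -> 'I_N).
Context (xbar : R -> 'cV[R]_n).
Unset Implicit Arguments.
Context (cK : compact K) (KX : K `<=` X) (gamy : times_to_infty gam).
Context (sol_ : forall k, solution X f (sigma_ k) (x_ k)).
Context (sw_ : forall k, switching_signal (sigma_ k)).
Context (domK : forall k t, - k%:R <= t <= k%:R ->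
  curve_dom (x_ k) (gam k + t) /\ K (x_ k (gam k + t))).
Context (xcvg : forall t, x_ k (gam k + t) @[k --> \oo] --> xbar t).
Set Implicit Arguments.

Lemma near_window (t : R) : \forall k \near \oo, - k%:R <= t <= k%:R.
Proof.
exists (Num.bound `|t|) => // k /= tk; rewrite -ler_norml.
apply: (@le_trans _ _ (Num.bound `|t|)%:R); last by rewrite ler_nat.
by apply/ltW; exact: archi_boundP.
Qed.

Lemma limit_in_compact (t : R) : K (xbar t).
Proof.
have clK : closed K by apply: compact_closed => //; exact: norm_hausdorff.
apply: (closed_cvg K clK _ _ (xcvg t)).
by apply: filterS (near_window t) => k /(domK _)[].
Qed.

Lemma window_lipschitz (M : R) : 0 <= M ->
  {ae mu, forall t, 0 <= t -> forall i xi, K xi -> `|f t xi i| <= M} ->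
  forall k c d, - k%:R <= c -> c <= d -> d <= k%:R ->
  `|x_ k (gam k + d) - x_ k (gam k + c)| <= M * (d - c).
Proof.
move=> M0 fM k c d kc cd dk.
have -> : d - c = (gam k + d) - (gam k + c) by ring.
apply: (solution_lipschitz (sol_ k) M0 fM); first by rewrite lerD2l.
move=> t /andP[ct td]; rewrite -(subrKC (gam k) t).
by apply: domK; apply/andP; split; lra.
Qed.

Lemma limit_lipschitz (M : R) : 0 <= M ->
  {ae mu, forall t, 0 <= t -> forall i xi, K xi -> `|f t xi i| <= M} ->
  forall c d, `|xbar d - xbar c| <= M * `|d - c|.
Proof.
move=> M0 fM c d; wlog cd : c d / c <= d.
  by move=> H; have /orP[/H//|/H] := le_total c d; rewrite distrC (distrC c).
have cvgd : `|x_ k (gam k + d) - x_ k (gam k + c)| @[k --> \oo] --> `|xbar d - xbar c|.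
  exact: (cvg_norm (cvgB (xcvg d) (xcvg c))).
rewrite -(cvg_lim _ cvgd)//; apply: limr_le; first by apply/cvg_ex; eexists; exact: cvgd.
apply: filterS2 (near_window c) (near_window d) => k /andP[kc _] /andP[_ dk].
by rewrite ger0_norm ?subr_ge0//; exact: window_lipschitz.
Qed.

Lemma ae_window_derive :
  {ae mu, forall s : R, forall k, - k%:R < s < k%:R ->
    is_derive s (1 : R) (fun t => x_ k (gam k + t))
      (f (gam k + s) (x_ k (gam k + s)) (sigma_ k (gam k + s)))}.
Proof.
apply: ae_countable => k; have [_ _ _ _ /ae_lebE dx] := sol_ k.
have := @ae_translation _ (gam k) _ dx; apply: ae_imp => s H /andP[/ltW ks /ltW sk].
have [|ds _] := domK k s; first by rewrite ks sk.
have := H ds; rewrite addrC => /is_derive_translation.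
rewrite (_ : (fun t => x_ k (t + gam k)) = (fun t => x_ k (gam k + t)))//.
by apply/funext => t; rewrite addrC.
Qed.

Lemma limit_integral (M Mphi : R) (phi v : 'I_N -> R -> R) (j : 'I_n) :
  0 <= M ->
  {ae mu, forall t, 0 <= t -> forall i xi, K xi -> `|f t xi i| <= M} ->
  (forall i, measurable_fun setT (phi i)) -> (forall i t, `|phi i t| <= Mphi) ->
  (forall i, measurable_fun setT (v i)) -> (forall i t, 0 <= v i t <= 1) ->
  (forall i a b, \int[mu]_(t in `[a, b]) (phi i t * (sigma_ k (gam k + t) == i)%:R)
     @[k --> \oo] --> \int[mu]_(t in `[a, b]) (phi i t * v i t)) ->
  {ae mu, forall s, f (gam k + s) (x_ k (gam k + s)) (sigma_ k (gam k + s)) j ord0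
     - phi (sigma_ k (gam k + s)) s @[k --> \oo] --> 0} ->
  forall a b, a < b ->
  xbar b j ord0 - xbar a j ord0 = \int[mu]_(t in `[a, b]) (\sum_i phi i t * v i t).
Proof.
move=> M0 fM mphi phiM mv v01 wc fphi a b ab.
pose c k i t : R := (sigma_ k (gam k + t) == i)%:R.
have mc k i : measurable_fun setT (c k i) by exact: switching_signal_indicator_measurable.
(* Exactly one mode is active at each time, so the sum reduces to its coefficient. *)
have sumc k t : \sum_i phi i t * c k i t = phi (sigma_ k (gam k + t)) t.
  rewrite (bigD1 (sigma_ k (gam k + t)))//= big1 ?addr0.
    by rewrite /c eqxx mulr1.
  by move=> i ni; rewrite /c eq_sym (negbTE ni) mulr0.
have phic_le (y : R) i t : 0 <= y <= 1 -> `|phi i t * y| <= Mphi.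
  move=> /andP[y0 y1]; rewrite normrM -[Mphi]mulr1 ler_pM//.
  by rewrite ger0_norm.
have c01 k i t : 0 <= c k i t <= 1 by rewrite /c; case: eqP; rewrite ?lexx ?ler01.
have /choice[D HD] : forall k, exists D : R -> R, [/\ measurable_fun setT D,
    forall t, `|D t| <= M &
    - k%:R <= a -> b <= k%:R ->
    {ae mu, forall t, a < t < b -> D t =
       f (gam k + t) (x_ k (gam k + t)) (sigma_ k (gam k + t)) j ord0} /\
    \int[mu]_(t in `[a, b]) D t = x_ k (gam k + b) j ord0 - x_ k (gam k + a) j ord0].
  move=> k; have [[ka bk]|nk] := pselect (- k%:R <= a /\ b <= k%:R); last first.
    (* For small [k] the window does not contain [[a, b]]; the zero function is a placeholder, as
       only large [k] enter the limits. *)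
    exists (cst 0); split; [exact: measurable_cst|by move=> t; rewrite normr0|].
    by move=> ka bk; exfalso; apply: nk.
  have [||D [mD DM Dd DI]] := @lipschitz_FTC R (fun t => x_ k (gam k + t) j ord0)
    (fun t => f (gam k + t) (x_ k (gam k + t)) (sigma_ k (gam k + t)) j ord0) a b M ab M0.
  - move=> s t /andP[as_ sb] /andP[at_ tb].
    have := norm_coord_le (x_ k (gam k + s) - x_ k (gam k + t)) j.
    rewrite !mxE => /le_trans; apply.
    have /orP[st|ts] := le_total s t.
      rewrite distrC (distrC s) (ger0_norm (_ : 0 <= t - s)) ?subr_ge0//.
      by apply: window_lipschitz => //; lra.
    rewrite (ger0_norm (_ : 0 <= s - t)) ?subr_ge0//.
    by apply: window_lipschitz => //; lra.
  - apply: ae_imp ae_window_derive => t H /andP[at_ tb].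
    apply: (@is_derive_coord _ _ (fun s => x_ k (gam k + s))); apply: H.
    by apply/andP; split; lra.
  by exists D.
have mD k : measurable_fun setT (D k) by have [] := HD k.
have DM k t : `|D k t| <= M by have [] := HD k.
(* D k is a Borel version of the j-th component of the derivative of the k-th shifted
   solution, so that r k is bounded and tends to 0 almost everywhere. *)
pose r k t := D k t - \sum_i phi i t * c k i t.
have mr k : measurable_fun setT (r k).
  apply: measurable_funB => //.
  by apply: measurable_sum => i; exact: measurable_funM.
have rM k t : `|r k t| <= M + Mphi.
  by rewrite /r sumc (le_trans (ler_normB _ _))// lerD.
have window : \forall k \near \oo, - k%:R <= a /\ b <= k%:R.
  by apply: filterS2 (near_window a) (near_window b) => k /andP[? _] /andP[_ ?].
have r0 : {ae mu, forall t, a < t < b -> r k t @[k --> \oo] --> (cst 0 t : R)}.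
  have aeD : {ae mu, forall t, forall k, - k%:R <= a /\ b <= k%:R -> a < t < b ->
      D k t = f (gam k + t) (x_ k (gam k + t)) (sigma_ k (gam k + t)) j ord0}.
    apply: ae_countable => k.
    have [[ka bk]|nk] := pselect (- k%:R <= a /\ b <= k%:R).
      by have [_ _ /(_ ka bk)[+ _]] := HD k; apply: ae_imp.
    by apply: nearW => t /nk.
  apply: ae_imp (ae_and aeD fphi) => t [H1 H2] tab.
  apply: cvg_trans H2; apply: near_eq_cvg.
  apply: filterS window => k kab.
  by rewrite /r sumc H1.
have ir0 : \int[mu]_(t in `[a, b]) r k t @[k --> \oo] --> (0 : R).
  have -> : (0 : R) = \int[mu]_(t in `[a, b]) (cst 0 t : R).
    by rewrite /Rintegral integral0_eq.
  by apply: (Rintegral_bounded_cvg mr _ rM r0); exact: measurable_cst.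
have isum : \sum_i \int[mu]_(t in `[a, b]) (phi i t * c k i t) @[k --> \oo] -->
    \sum_i \int[mu]_(t in `[a, b]) (phi i t * v i t).
  apply: cvg_big => [|i _]; [exact: add_continuous|exact: wc].
rewrite (@Rintegral_sum_bounded _ 'I_N a b Mphi); last 2 first.
- by move=> i; exact: measurable_funM.
- by move=> i t; exact: phic_le.
have Hs : \int[mu]_(t in `[a, b]) r k t +
    \sum_i \int[mu]_(t in `[a, b]) (phi i t * c k i t) @[k --> \oo] -->
    \sum_i \int[mu]_(t in `[a, b]) (phi i t * v i t).
  by rewrite -[X in _ --> X]add0r; exact: (cvgD ir0 isum).
have Hx : x_ k (gam k + b) j ord0 - x_ k (gam k + a) j ord0 @[k --> \oo] -->
    xbar b j ord0 - xbar a j ord0.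
  exact: (cvgB (cvg_coord (xcvg b)) (cvg_coord (xcvg a))).
suff Hxs : x_ k (gam k + b) j ord0 - x_ k (gam k + a) j ord0 @[k --> \oo] -->
    \sum_i \int[mu]_(t in `[a, b]) (phi i t * v i t).
  exact: (cvg_unique _ Hx Hxs).
(* For large [k] the increment is the integral of [D k], which splits into that of [r k] and the
   integrals of [phi i] times the mode indicators. *)
apply: cvg_trans Hs; apply: near_eq_cvg.
apply: filterS window => k [ka bk].
have [_ _ /(_ ka bk)[_ <-]] := HD k.
rewrite -(@Rintegral_sum_bounded _ 'I_N a b Mphi); last 2 first.
- by move=> i; exact: measurable_funM.
- by move=> i t; exact: phic_le.
rewrite -RintegralD//.
- by apply: eq_Rintegral => t _; rewrite /r subrK.
- exact: (bounded_measurable_integrable _ _ (mr k) (rM k)).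
- apply: (@bounded_measurable_integrable _ _ _ Mphi).
    by apply: measurable_sum => i; exact: measurable_funM.
  by move=> t; rewrite sumc.
Qed.

Context (ubar : R -> 'cV[R]_N) (cu : controls ubar).
Context (wc : weakly_converges (fun k t => control_of (sigma_ k) (gam k + t)) ubar).

Lemma limit_derivative (Mf : R) (h : R -> 'cV[R]_n -> 'I_N -> 'cV[R]_p)
    (fhat Deltaf fl : R -> 'cV[R]_n -> 'I_N -> 'cV[R]_n) (eps : R) :
  0 <= Mf -> {ae mu, forall t, 0 <= t -> forall i xi, K xi -> `|f t xi i| <= Mf} ->
  (forall i t xi, 0 <= t -> X xi -> f t xi i = fhat t xi i + Deltaf t xi i) ->
  (forall i, uniformly_bounded nonneg_times X (fun t xi => fhat t xi i)) ->
  (forall i, measurable_in_time nonneg_times X (fun t xi => fhat t xi i)) ->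
  (forall i, continuous_in_state_uniformly nonneg_times X (fun t xi => fhat t xi i)) ->
  (forall i, limiting_function X (fun t xi => fhat t xi i) gam (fun t xi => fl t xi i)) ->
  (forall i, zeroing_pair X (fun t xi => h t xi i) (fun t xi => Deltaf t xi i)) ->
  0 < eps ->
  (forall k t, - k%:R <= t <= k%:R -> eps <= `|x_ k (gam k + t)|) ->
  {ae mu, forall t, h (gam k + t) (x_ k (gam k + t)) (sigma_ k (gam k + t))
     @[k --> \oo] --> (0 : 'cV[R]_p)} ->
  {ae mu, forall t, is_derive t (1 : R) xbar (Fhat fl t (xbar t) *m ubar t)}.
Proof.
move=> Mf0 fM fE bf mf cf lf zp eps0 epsx h0.
have cx := lipschitz_continuous Mf0 (limit_lipschitz Mf0 fM).
have /choice[v Hv] := fun i => weak_limit_coord i sw_ cu wc.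
have nonneg t : \forall k \near \oo, 0 <= gam k + t by exact: times_to_infty_near.
have Kx t : \forall k \near \oo, K (x_ k (gam k + t)).
  by apply: filterS (near_window t) => k /(domK _)[].
have cvgf : {ae mu, forall t, forall i, fhat (gam k + t) (x_ k (gam k + t)) i
    @[k --> \oo] --> fl t (xbar t) i}.
  apply: ae_countable => i.
  exact: (limiting_function_along gamy (cf i) (lf i) cK KX limit_in_compact Kx xcvg).
have cvgDelta : {ae mu, forall t,
    Deltaf (gam k + t) (x_ k (gam k + t)) (sigma_ k (gam k + t)) @[k --> \oo] --> (0 : 'cV[R]_n)}.
  apply: ae_imp h0 => t; apply: (zeroing_pair_switched zp cK KX eps0).
    have [_ gy] := gamy; apply/cvgryPge => A.
    by move/cvgryPge : gy => /(_ (A - t)); apply: filterS => k; rewrite lerBlDr.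
  apply: filterS2 (near_window t) (nonneg t) => k kt k0.
  by split => //; [have [] := domK k t kt|exact: epsx].
suff H : forall j : 'I_n, {ae mu, forall t, is_derive t (1 : R) (fun s => xbar s j ord0)
    ((Fhat fl t (xbar t) *m ubar t) j ord0)}.
  by apply: ae_imp (ae_countable H) => t Ht; exact: is_derive_col.
move=> j.
have /choice[phi Hphi] : forall i, exists phi : R -> R, [/\ measurable_fun setT phi,
    exists M, forall s, `|phi s| <= M & {ae mu, forall s, fl s (xbar s) i j ord0 = phi s}].
  move=> i; have [M M0 [phi [h1 h2 h3]]] := limiting_function_Borel j gamy (mf i) (cf i)
    (bf i) (lf i) cK KX cx limit_in_compact.
  by exists phi; split => //; exists M.
have /choice[M HM] : forall i, exists M, forall s, `|phi i s| <= M.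
  by move=> i; have [] := Hphi i.
pose Mphi := \sum_i `|M i|.
have phiM i s : `|phi i s| <= Mphi.
  rewrite (le_trans (HM i s))// (le_trans (ler_norm _))// /Mphi.
  by rewrite (bigD1 i)//= lerDl sumr_ge0.
have mphi i : measurable_fun setT (phi i) by have [] := Hphi i.
have mv i : measurable_fun setT (v i) by have [] := Hv i.
have v01 i t : 0 <= v i t <= 1 by have [] := Hv i.
have phiE : {ae mu, forall s, forall i, fl s (xbar s) i j ord0 = phi i s}.
  by apply: ae_countable => i; have [] := Hphi i.
have vE : {ae mu, forall s, forall i, ubar s i ord0 = v i s}.
  by apply: ae_countable => i; have [] := Hv i.
have fphi : {ae mu, forall s, f (gam k + s) (x_ k (gam k + s)) (sigma_ k (gam k + s)) j ord0
     - phi (sigma_ k (gam k + s)) s @[k --> \oo] --> 0}.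
  apply: ae_imp (ae_and (ae_and cvgf cvgDelta) phiE) => t [[H1 H2] H3].
  (* The active mode varies with [k], so its error is bounded by the sum of the errors over all
     modes. *)
  pose d k i := fhat (gam k + t) (x_ k (gam k + t)) i j ord0 - fl t (xbar t) i j ord0.
  have d0 : \sum_i `|d k i| @[k --> \oo] --> (0 : R).
    rewrite [X in _ --> X](_ : _ = \sum_(i < N) 0); last by rewrite big1.
    apply: cvg_big => [|i _]; first exact: add_continuous.
    exact: (@cvg_norm_sub0 _ _ (fun k => fhat (gam k + t) (x_ k (gam k + t)) i j ord0)
      _ (cvg_coord (H1 i))).
  have b0 : \sum_i `|d k i| +
      `|Deltaf (gam k + t) (x_ k (gam k + t)) (sigma_ k (gam k + t))| @[k --> \oo] --> (0 : R).
    rewrite -[X in _ --> X]addr0; exact: (cvgD d0 (cvg_norm0 H2)).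
  apply/norm_cvg0P; apply: (squeeze_cvgr _ (cvg_cst 0) b0).
  apply: filterS2 (nonneg t) (Kx t) => k k0 Kk.
  rewrite normr_ge0/= fE//; last exact: KX.
  rewrite mxE -H3 addrAC (le_trans (ler_normD _ _))// lerD//; last exact: norm_coord_le.
  by rewrite (bigD1 (sigma_ k (gam k + t)))//= lerDl sumr_ge0.
have xint := limit_integral Mf0 fM mphi phiM mv v01 (fun i a b =>
  let: And4 _ _ _ w := Hv i in w (phi i) Mphi a b (mphi i) (phiM i)) fphi.
have mF : measurable_fun setT (fun t => \sum_i phi i t * v i t).
  by apply: measurable_sum => i; exact: measurable_funM.
have FM t : `|\sum_i phi i t * v i t| <= \sum_(i < N) Mphi.
  apply: (le_trans (ler_norm_sum _ _ _)); apply: ler_sum => i _.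
  have /andP[v0 v1] := v01 i t.
  by rewrite normrM -[Mphi]mulr1 ler_pM// ger0_norm.
apply: ae_imp (ae_and (ae_and (integral_derivative mF FM xint) phiE) vE) => t [[H1 H2] H3].
rewrite (_ : (Fhat _ _ _ *m _) _ _ = \sum_i phi i t * v i t)//.
by rewrite mxE; apply: eq_bigr => i _; rewrite mxE H2 H3.
Qed.

Lemma limit_output (h hl : R -> 'cV[R]_n -> 'I_N -> 'cV[R]_p) :
  continuous xbar ->
  (forall i, uniformly_bounded nonneg_times X (fun t xi => h t xi i)) ->
  (forall i, measurable_in_time nonneg_times X (fun t xi => h t xi i)) ->
  (forall i, continuous_in_state_uniformly nonneg_times X (fun t xi => h t xi i)) ->
  (forall i, limiting_function X (fun t xi => h t xi i) gam (fun t xi => hl t xi i)) ->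
  {ae mu, forall t, h (gam k + t) (x_ k (gam k + t)) (sigma_ k (gam k + t))
     @[k --> \oo] --> (0 : 'cV[R]_p)} ->
  {ae mu, forall t, Hhat hl t (xbar t) *m ubar t = 0}.
Proof.
move=> cx bh mh ch lh h0.
have Kx t : \forall k \near \oo, K (x_ k (gam k + t)).
  by apply: filterS (near_window t) => k /(domK _)[].
have cvgh : {ae mu, forall t, forall i, h (gam k + t) (x_ k (gam k + t)) i
    @[k --> \oo] --> hl t (xbar t) i}.
  apply: ae_countable => i.
  exact: (limiting_function_along gamy (ch i) (lh i) cK KX limit_in_compact Kx xcvg).
(* Where [ubar t i] is nonzero, these identities force every component of [hl t (xbar t) i] to
   vanish. *)
suff H : forall ij : 'I_N * 'I_p, {ae mu, forall t,
    `|hl t (xbar t) ij.1 ij.2 ord0| * ubar t ij.1 ord0 = 0}.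
  apply: ae_imp (ae_countable H) => t Ht.
  apply/matrixP => a b; rewrite !mxE big1// => i _; rewrite mxE (ord1 b).
  have [->|ui] := eqVneq (ubar t i ord0) 0; first by rewrite mulr0.
  rewrite (_ : hl t (xbar t) i = 0) ?normr0 ?mul0r//.
  apply/colP => j; rewrite mxE; apply/eqP; rewrite -normr_eq0.
  by have /eqP := Ht (i, j); rewrite mulf_eq0 (negbTE ui) orbF.
move=> [i j] /=.
have [v [mv v01 vE wv]] := weak_limit_coord i sw_ cu wc.
have [M M0 [phi [mphi phiM phiE]]] := limiting_function_Borel j gamy (mh i) (ch i)
    (bh i) (lh i) cK KX cx limit_in_compact.
pose eta t := `|phi t|.
have meta : measurable_fun setT eta by exact: measurableT_comp.
have etaM t : 0 <= eta t <= M by rewrite normr_ge0 phiM.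
have vanish : {ae mu, forall t, eta t * v t = 0}.
  apply: (weak_limit_vanishing (c := fun k t => (sigma_ k (gam k + t) == i)%:R)
    meta mv v01 _ _ etaM).
  - by move=> k; exact: switching_signal_indicator_measurable.
  - by move=> k t; case: eqP; rewrite ?lexx ?ler01.
  - by move=> a b; apply: (wv eta M a b meta) => t; rewrite normr_id.
  - apply: ae_imp (ae_and (ae_and cvgh h0) phiE) => t [[H1 H2] H3].
    (* When mode [i] is active, the output of mode [i] is the actual output, so [eta] is at most
       this sum; otherwise the indicator makes the product 0. *)
    have b0 : `|h (gam k + t) (x_ k (gam k + t)) i - hl t (xbar t) i| +
        `|h (gam k + t) (x_ k (gam k + t)) (sigma_ k (gam k + t))| @[k --> \oo] --> (0 : R).
      rewrite -[X in _ --> X]addr0.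
      exact: (cvgD (cvg_norm_sub0 (H1 i)) (cvg_norm0 H2)).
    apply: (squeeze_cvgr _ (cvg_cst 0) b0); apply: nearW => k.
    apply/andP; split; first by apply: mulr_ge0 => //; exact: normr_ge0.
    have [->|_] := eqVneq (sigma_ k (gam k + t)) i; last first.
      by rewrite mulr0 addr_ge0.
    rewrite mulr1 /eta -H3 (le_trans (norm_coord_le _ _))//.
    rewrite -[X in `|X| <= _](subKr (h (gam k + t) (x_ k (gam k + t)) i)).
    by rewrite (le_trans (ler_normB _ _))// addrC.
by apply: ae_imp (ae_and (ae_and vanish phiE) vE) => t [[H1 H2] H3]; rewrite H2 H3.
Qed.

Lemma limit_control_set (chi : 'I_N -> set 'cV[R]_n) :
  continuous xbar -> (forall i, closed (chi i)) ->
  (forall k t, curve_dom (x_ k) t -> chi (sigma_ k t) (x_ k t)) ->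
  {ae mu, forall t, control_set_at chi (xbar t) (ubar t)}.
Proof.
move=> cx clchi inv.
suff H : forall i, {ae mu, forall t, ubar t i ord0 != 0 -> chi i (xbar t)}.
  apply: ae_imp (ae_countable H) => t Ht.
  by apply: simplex_control_set_at => //; have [_] := cu; exact.
move=> i.
have [v [mv v01 vE wv]] := weak_limit_coord i sw_ cu wc.
pose A := xbar @^-1` (~` chi i).
have oA : open A by apply: open_comp; [move=> t _; exact: cx|exact: closed_openC].
pose eta : R -> R := \1_A.
have meta : measurable_fun setT eta by apply: measurable_indic; exact: open_measurable.
have eta01 t : 0 <= eta t <= 1 by rewrite /eta indicE; case: (_ \in _); rewrite ?lexx ?ler01.
have vanish : {ae mu, forall t, eta t * v t = 0}.
  apply: (weak_limit_vanishing (c := fun k t => (sigma_ k (gam k + t) == i)%:R)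
    meta mv v01 _ _ eta01).
  - by move=> k; exact: switching_signal_indicator_measurable.
  - by move=> k t; case: eqP; rewrite ?lexx ?ler01.
  - by move=> a b; apply: (wv eta 1 a b meta) => t; have /andP[? ?] := eta01 t; rewrite ger0_norm.
  - apply: nearW => t; have [At|nAt] := pselect (A t); last first.
      rewrite /eta indicE memNset//; under eq_fun do rewrite mul0r; exact: cvg_cst.
    apply: cvg_near_cst.
    (* Outside the closed set [chi i] the approximating states eventually also lie outside it, and
       invariance then excludes mode [i]; the products are eventually 0. *)
    have : \forall k \near \oo, (~` chi i) (x_ k (gam k + t)).
      apply: (xcvg t); apply: open_nbhs_nbhs; split => //; exact: closed_openC.
    apply: filterS2 (near_window t) => k kt nchi.
    case: eqP => [E|_]; last by rewrite mulr0.
    by exfalso; apply: nchi; rewrite -E; apply: inv; have [] := domK k t kt.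
apply: ae_imp (ae_and vanish vE) => t [H1 H2] u0; apply: contrapT => nchi.
move: H1; rewrite /eta indicE mem_set// mul1r -H2 => /eqP.
by rewrite (negbTE u0).
Qed.

End limiting_trajectories.

(** * The limiting trajectory solves the reduced limiting control system *)

Lemma uniform_cvg_pointwise (R : realType) (V : normedModType R) (A : set R)
    (u : nat -> R -> V) (v : R -> V) (t : R) :
  {uniform A, u @ \oo --> v} -> A t -> u k t @[k --> \oo] --> v t.
Proof.
move=> uv At; apply/cvgrPdist_lt => e e0.
apply: (uv [set w | `|v t - w t| < e]).
apply/uniform_nbhs; exists [set xy | ball xy.1 e xy.2]; split.
  exact: (entourage_ball V (PosNum e0)).
by move=> w /(_ t At); rewrite /= -ball_normE.
Qed.

Theorem mainTheorem5 (R : realType) (n p N : nat) (X : set 'cV[R]_n)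
    (f : R -> 'cV[R]_n -> 'I_N -> 'cV[R]_n)
    (h : R -> 'cV[R]_n -> 'I_N -> 'cV[R]_p)
    (fhat Deltaf : R -> 'cV[R]_n -> 'I_N -> 'cV[R]_n)
    (T : set (curve R n * (R -> 'I_N)))
    (chi : 'I_N -> set 'cV[R]_n)
    (xbar : R -> 'cV[R]_n) (ubar : R -> 'cV[R]_N) :
  open X -> X 0 ->
  standing_assumption X f h ->
  (forall i, uniformly_bounded nonneg_times X (fun t xi => f t xi i)) ->
  (forall i,
    [/\ uniformly_bounded nonneg_times X (fun t xi => h t xi i),
        measurable_in_time nonneg_times X (fun t xi => h t xi i),
        continuous_in_state_uniformly nonneg_times X (fun t xi => h t xi i) &
        precompact_in_time X (fun t xi => h t xi i)]) ->
  (forall i t xi, 0 <= t -> X xi -> f t xi i = fhat t xi i + Deltaf t xi i) ->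
  (forall i,
    [/\ uniformly_bounded nonneg_times X (fun t xi => fhat t xi i),
        measurable_in_time nonneg_times X (fun t xi => fhat t xi i),
        continuous_in_state_uniformly nonneg_times X
          (fun t xi => fhat t xi i) &
        precompact_in_time X (fun t xi => fhat t xi i)]) ->
  (forall i, zeroing_pair X (fun t xi => h t xi i)
                            (fun t xi => Deltaf t xi i)) ->
  T `<=` trajectory X f ->
  closed_covering chi ->
  invariant_wrt T chi ->
  zeroing_output_limiting_trajectory X h T xbar ubar ->
  exists2 gamma : nat -> R, common_admissible X fhat h gamma &
    forall (fl : R -> 'cV[R]_n -> 'I_N -> 'cV[R]_n)
           (hl : R -> 'cV[R]_n -> 'I_N -> 'cV[R]_p),
      (forall i, limiting_function X (fun t xi => fhat t xi i) gamma
                   (fun t xi => fl t xi i)) ->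
      (forall i, limiting_function X (fun t xi => h t xi i) gamma
                   (fun t xi => hl t xi i)) ->
      complete_trajectory X chi T fl hl xbar ubar /\ bounded_in X xbar.
Proof.
move=> _ _ _ bf hyp_h fE hyp_f zp Ttraj [clchi _] inv [t_ [x0_ [s0_ [Hlim Hzero]]]].
case: Hlim => -[Xx cu] ty TT [[K [cK KX domK0]] unif] wc0.
case: Hzero => _ _ _ [K' [eps [_ _ eps0 epsx0]]] h0.
have bfh i : uniformly_bounded nonneg_times X (fun t xi => fhat t xi i) by have [] := hyp_f i.
have mfh i : measurable_in_time nonneg_times X (fun t xi => fhat t xi i) by have [] := hyp_f i.
have cfh i : continuous_in_state_uniformly nonneg_times X (fun t xi => fhat t xi i).
  by have [] := hyp_f i.
have pfh i : precompact_in_time X (fun t xi => fhat t xi i) by have [] := hyp_f i.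
have bh i : uniformly_bounded nonneg_times X (fun t xi => h t xi i) by have [] := hyp_h i.
have mh i : measurable_in_time nonneg_times X (fun t xi => h t xi i) by have [] := hyp_h i.
have ch i : continuous_in_state_uniformly nonneg_times X (fun t xi => h t xi i).
  by have [] := hyp_h i.
have ph i : precompact_in_time X (fun t xi => h t xi i) by have [] := hyp_h i.
have [phi hphi adm] := common_admissible_subseq pfh ph ty.
exists (t_ \o phi) => // fl hl lfl lhl.
have phik := homo_ltn_geq hphi; have phioo := cvg_infty_geq phik.
have gamy := times_to_infty_subseq hphi ty.
pose gam := t_ \o phi; pose x_ := x0_ \o phi; pose sigma_ := s0_ \o phi.
have traj k : trajectory X f (x0_ k, s0_ k) by exact/Ttraj/TT.
have sw_ k : switching_signal (sigma_ k) by have [] := traj (phi k).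
have sol_ k : solution X f (sigma_ k) (x_ k) by have [_ []] := traj (phi k).
(* Since [k <= phi k], the window of index [k] lies in that of index [phi k], so the window
   conditions survive reindexing. *)
have window (k : nat) (t : R) : - k%:R <= t <= k%:R -> - (phi k)%:R <= t <= (phi k)%:R.
  rewrite -!ler_norml => /le_trans; apply; by rewrite ler_nat.
have domK k t : - k%:R <= t <= k%:R -> curve_dom (x_ k) (gam k + t) /\ K (x_ k (gam k + t)).
  move=> /window /andP[h1 h2]; apply: (domK0 (phi k)).
  by rewrite /gam /= !lerD2l h1.
have xcvg t : x_ k (gam k + t) @[k --> \oo] --> xbar t.
  (* The radius [|t| + 1] is positive even at [t = 0]. *)
  have S0 : 0 < `|t| + 1 by rewrite ltr_wpDl.
  have tS : `[- (`|t| + 1), `|t| + 1]%classic t.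
    by rewrite /= in_itv/= -ler_norml lerDl.
  exact: (cvg_comp phi _ phioo (uniform_cvg_pointwise (unif _ S0) tS)).
have wc : weakly_converges (fun k t => control_of (sigma_ k) (gam k + t)) ubar.
  by move=> psi ipsi; exact: (cvg_comp phi _ phioo (wc0 psi ipsi)).
have epsx k t : - k%:R <= t <= k%:R -> eps <= `|x_ k (gam k + t)|.
  by move=> /window /epsx0[].
have hcvg : {ae lebesgue_measure, forall t,
    h (gam k + t) (x_ k (gam k + t)) (sigma_ k (gam k + t)) @[k --> \oo] --> (0 : 'cV[R]_p)}.
  move/ae_lebE : h0; apply: ae_imp => t ht; exact: (cvg_comp phi _ phioo ht).
have [M M0 fM] := uniformly_bounded_family bf cK KX.
have lx := limit_lipschitz sol_ domK xcvg M0 fM.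
have cx := lipschitz_continuous M0 lx.
have Kx := limit_in_compact cK domK xcvg.
split; last by exists K; split => // _ [t _ <-].
split => //.
- by move=> a b _; exact: lipschitz_absolutely_continuous M0 lx.
(* Membership of [ubar] in the limiting controls is witnessed by the original sequence, before
   extraction. *)
- split => //; exists t_, s0_; split => //; first by have [] := ty.
  by move=> k; split; [have [] := traj k|exists (x0_ k)].
- apply/ae_lebE.
  have d1 := limit_control_set sw_ domK xcvg cu wc cx clchi (fun k t => inv _ _ (TT (phi k)) t).
  have d2 := limit_derivative cK KX gamy sol_ sw_ domK xcvg cu wc M0 fM fE bfh mfh cfh lfl zp
    eps0 epsx hcvg.
  have d3 := limit_output cK KX gamy sw_ domK xcvg cu wc cx bh mh ch lhl hcvg.
  by apply: ae_imp (ae_and (ae_and d1 d2) d3) => t [[? ?] ?].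
Qed.
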